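(* Let $d>1$ and let $\{f_n\}_{n\ge 1}$ be a $d$-decaying Gauss like iterated function system on $[0,1]$. Then the $t$-conformal measure $m$ of the system (where $t\ge0$ satisfies $P(t)=0$) is the $1$-dimensional Lebesgue measure $\mathcal{L}$ on $[0,1]$. Moreover, there exists an ergodic invariant probability measure $m^{*}$ (for the digit shift map $T$) which is equivalent to $\mathcal{L}$, i.e. $m^*$ and $\mathcal L$ are mutually absolutely continuous.
   Context: $\mathbb{N}=\{1,2,3,\dots\}$. Let $d>1$. A sequence $\{f_n\}_{n\ge1}$ of $C^1$ functions $f_n:[0,1]\to[0,1]$ is a $d$-decaying Gauss like iterated function system if: (i) (open set condition) $f_i((0,1))\cap f_j((0,1))=\emptyset$ for all $i\ne j$ in $\mathbb{N}$; (ii) (contraction) there exist $q\in\mathbb{N}$ and $0<\rho<1$ such that $0<|(f_{a_1}\circ\cdots\circ f_{a_q})'(x)|\le\rho<1$ for all $(a_1,\dots,a_q)\in\mathbb{N}^q$ and $x\in[0,1]$; (iii) (regularity) for every $\varepsilon>0$ there are constants $C_1=C_1(\varepsilon)>0$, $C_2=C_2(\varepsilon)>0$ such that for each $i\in\mathbb{N}$ there are constants $\xi_i,\lambda_i$ with $\xi_i\le|f_i'(x)|\le\lambda_i$ for all $x\in[0,1]$ and $\frac{C_1}{i^{d+\varepsilon}}\le\xi_i\le\lambda_i\le\frac{C_2}{i^{d-\varepsilon}}$; (iv) $\bigcup_{i=1}^\infty f_i([0,1])=(0,1]$, and $f_i(x)<f_j(x)$ whenever $i>j$; (v) (bounded distortion)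 there is $\kappa\ge1$ such that for every $n\in\mathbb{N}$ and $(a_1,\dots,a_n)\in\mathbb{N}^n$, $|(f_{a_1}\circ\cdots\circ f_{a_n})'(x)|\le\kappa\,|(f_{a_1}\circ\cdots\circ f_{a_n})'(y)|$ for all $x,y\in[0,1]$. For $\underline a=\{a_n\}_{n\ge1}\in\mathbb{N}^{\mathbb{N}}$ put $\Pi(\underline a)=\lim_{n\to\infty}f_{a_1}\circ\cdots\circ f_{a_n}(1)$. The attractor is $J=\Pi(\mathbb{N}^{\mathbb{N}})$, which satisfies $J=\bigcup_{i}f_i(J)$. All but countably many $x\in[0,1]$ have exactly one $\underline a$ with $\Pi(\underline a)=x$; on such points the digit shift map is $T(\Pi(a_1,a_2,a_3,\dots))=\Pi(a_2,a_3,\dots)$, so that $T(f_i(y))=y$. A probability measure $m^*$ on $[0,1]$ giving no mass to the countable exceptional set is invariant if $m^*(T^{-1}A)=m^*(A)$ for all Borel $A$, and ergodic if every Borel $A$ with $m^*(A\,\triangle\,T^{-1}A)=0$ has $m^*(A)\in\{0,1\}$. For $\omega=(\omega_1,\dots,\omega_n)\in\mathbb{N}^n$ write $f_\omega=f_{\omega_1}\circ\cdots\circ f_{\omega_n}$ and $\|f_\omega'\|=\sup_{x\in[0,1]}|f_\omega'(x)|$. The topological pressure is $P(t)=\lim_{n\to\infty}\frac1n\log\sum_{\omega\in\mathbb{N}^n}\|f_\omega'\|^t$. A Borel probability measure $m$ is $t$-conformal if it is supported on $J$ (i.e. $m(J)=1$) and, for every Borel set $A\subseteq[0,1]$ and all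 $i\neq j$ in $\mathbb{N}$, $m(f_i(A))=\int_A|f_i'|^t\,dm$ and $m(f_i([0,1])\cap f_j([0,1]))=0$. *)

(* Defs.v *)
From HB Require Import structures.
From mathcomp Require Import all_boot all_order all_algebra.
From mathcomp Require Import all_classical all_reals all_analysis.

Set Implicit Arguments.
Unset Strict Implicit.
Unset Printing Implicit Defensive.

Import Order.TTheory GRing.Theory Num.Theory.
Import numFieldNormedType.Exports.

Local Open Scope classical_set_scope.
Local Open Scope ring_scope.

(* Functions [0,1] -> [0,1] are represented by functions R -> R whose values
   outside [0,1] are never used.  The digits 1, 2, 3, ... are represented by
   0, 1, 2, ...: [f i] stands for the map f_{i+1}. *)

Section unit_interval.
Context {R : realType}.
Implicit Type g : R -> R.

Definition unit_itv : set R := [set` `[0%R, 1%R]].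

Definition diff_quotient g (x : R) : R -> R := fun y => (g y - g x) / (y - x).

(* The limit is taken within [0,1], so it is one-sided at 0 and at 1. *)
Definition derivable01 g (x : R) : Prop :=
  cvg (diff_quotient g x y @[y --> within unit_itv x^']).

Definition derive01 g (x : R) : R :=
  lim (diff_quotient g x y @[y --> within unit_itv x^']).

Definition C1_01 g : Prop :=
  (forall x, unit_itv x -> derivable01 g x) /\
  {within unit_itv, continuous (derive01 g)}.

Definition sup_deriv g : R := sup [set `|derive01 g x| | x in unit_itv].

End unit_interval.

Section ifs.
Context {R : realType}.
Implicit Types (f : nat -> R -> R) (w : seq nat) (a : nat -> nat).

(* word_map f [:: a1; ...; an] is f a1 \o ... \o f an *)
Definition word_map f w : R -> R := fun x => foldr f x w.

Record decaying_gauss_like (d : R) f : Prop := DecayingGaussLike {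
  gauss_maps : forall i x, unit_itv x -> unit_itv (f i x) ;
  gauss_C1 : forall i, C1_01 (f i) ;
  gauss_open_set : forall i j : nat, i != j ->
    (f i @` [set` `]0%R, 1%R[]) `&` (f j @` [set` `]0%R, 1%R[]) = set0 ;
  gauss_contraction : exists (q : nat) (rho : R),
    [/\ (0 < q)%N, 0 < rho, rho < 1 &
      forall w x, size w = q -> unit_itv x ->
        0 < `|derive01 (word_map f w) x| <= rho] ;
  gauss_regularity : forall e : R, 0 < e -> exists C1 C2 : R,
    [/\ 0 < C1, 0 < C2 &
      forall i : nat, exists xi lambda : R,
        (forall x, unit_itv x -> xi <= `|derive01 (f i) x| <= lambda) /\
        [/\ C1 / (i.+1%:R `^ (d + e)) <= xi, xi <= lambda &
            lambda <= C2 / (i.+1%:R `^ (d - e))]] ;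
  gauss_cover : \bigcup_i (f i @` unit_itv) = [set` `]0%R, 1%R]] ;
  gauss_order : forall i j x, (j < i)%N -> unit_itv x -> f i x < f j x ;
  gauss_distortion : exists2 kappa : R, 1 <= kappa &
    forall w x y, (0 < size w)%N -> unit_itv x -> unit_itv y ->
      `|derive01 (word_map f w) x| <= kappa * `|derive01 (word_map f w) y|
}.

Definition coding f a : R := lim (word_map f (mkseq a n) 1 @[n --> \oo]).

Definition attractor f : set R := range (coding f).

Definition uniquely_coded f : set R := [set x | exists! a, coding f a = x].

Definition digits f (x : R) : nat -> nat := get [set a | coding f a = x].

(* Only meaningful on [uniquely_coded f]. *)
Definition digit_shift f (x : R) : R := coding f (fun n => digits f x n.+1).

Definition shift_preimage f (A : set R) : set R :=
  uniquely_coded f `&` (digit_shift f @^-1` A).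

Definition pressure_seq f (t : R) (n : nat) : \bar R :=
  ((n%:R^-1)%:E *
    lne (\esum_(w in [set w : seq nat | size w = n])
           (sup_deriv (word_map f w) `^ t)%:E))%E.

(* P(t) = p.  It is stated as convergence in the extended reals because [lim]
   of a divergent sequence is an arbitrary value, possibly 0. *)
Definition pressure_is f (t : R) (p : \bar R) : Prop :=
  pressure_seq f t n @[n --> \oo] --> p.

Local Notation borelR := (measurableTypeR R).

Definition conformal f (t : R) (m : probability borelR R) : Prop :=
  [/\ m (attractor f) = 1%E,
      (forall (i : nat) (A : set borelR), measurable A -> A `<=` unit_itv ->
         m (f i @` A) = \int[m]_(x in A) (`|derive01 (f i) x| `^ t)%:E)%E &
      (forall i j : nat, i != j ->
         m ((f i @` unit_itv) `&` (f j @` unit_itv)) = 0%E)].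

Definition shift_invariant f (m : probability borelR R) : Prop :=
  [/\ m unit_itv = 1%E, m (unit_itv `\` uniquely_coded f) = 0%E &
      forall A : set borelR, measurable A ->
        measurable (shift_preimage f A : set borelR) /\
        m (shift_preimage f A) = m A].

Definition shift_ergodic f (m : probability borelR R) : Prop :=
  forall A : set borelR, measurable A ->
    m (A `+` shift_preimage f A) = 0%E -> m A = 0%E \/ m A = 1%E.

Lemma measurable_unit_itv : measurable (unit_itv : set borelR).
Proof. exact: measurable_itv. Qed.

Definition lebesgue01 : set borelR -> \bar R :=
  mrestr lebesgue_measure measurable_unit_itv.

HB.instance Definition _ := Measure.on lebesgue01.

Lemma lebesgue01_setT : lebesgue01 setT = 1%E.
Proof.
rewrite /lebesgue01 /mrestr setTI /unit_itv lebesgue_measure_itv/= lte_fin ltr01.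
by rewrite oppr0 adde0.
Qed.

HB.instance Definition _ :=
  Measure_isProbability.Build _ _ R lebesgue01 lebesgue01_setT.

End ifs.

(* Main.v *)
Require Import Defs.
From HB Require Import structures.
From mathcomp Require Import all_boot all_order all_algebra.
From mathcomp Require Import all_classical all_reals all_analysis.
From mathcomp Require Import measurable_realfun ring lra.
Import Order.TTheory GRing.Theory Num.Theory.
Import numFieldNormedType.Exports.
Local Open Scope classical_set_scope.
Local Open Scope ring_scope.

(** Cylinders [f_w [0,1]] of equal length cover [0,1] and overlap only in the
    countable set of points [f_w 0], [f_w 1], so their lengths sum to 1, and
    bounded distortion makes each length comparable with [sup |f_w'|].  Hence
    [P(1) = 0], and exponential contraction excludes any other zero of [P].

    Lebesgue measure is 1-conformal by change of variables.  If [m] is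
    1-conformal and [m <= C Leb], then writing
    [m (f_w I) = s + \int (|f_w'| - s) dm] with [s = sup |f_w'| / kappa] shows
    [m <= (C - (C - 1) / kappa) Leb] on cylinders, hence on Borel sets.
    Iterating from [C = kappa] gives [m <= Leb], hence [m = Leb].

    The invariant measure is the limit of [1/n \sum_(k < n) Leb (T^-k A)] along
    an ultrafilter; it is countably additive because it lies between
    [Leb / kappa] and [kappa Leb].  If [A] is invariant then
    [Leb (A `&` f_w I) >= Leb A * Leb (f_w I) / kappa] on every cylinder, so
    [Leb (B `\` A) <= (1 - Leb A / kappa) Leb B] for all Borel [B], and
    [B = ~` A] gives ergodicity. *)

Set Implicit Arguments.
Unset Strict Implicit.
Unset Printing Implicit Defensive.

(** * One-sided derivatives on [0,1] *)

(** A conformal measure is not known in advance to give mass 0 to the countable set of cylinder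
    endpoints, so cylinders of equal length cannot be treated as disjoint for it. The comparison of
    [m] with Lebesgue measure therefore uses only subadditivity of [m], and keeps exact additivity
    for Lebesgue measure. The map sending C to C - (C - 1)/kappa fixes 1 and shrinks the excess C -
    1 by the factor 1 - 1/kappa; the limit bound m <= Leb, applied to complements, is then an
    equality. The same passage from cylinders to Borel sets is used for ergodicity, with Lebesgue
    measure restricted to the complement of A in the role of [m]; it stands in for an argument by
    density points. Lebesgue measure need not be invariant, and its averages along T^-k are not
    known to converge. An ultrafilter makes the averages of all Borel sets converge at once and
    keeps finite additivity and invariance; domination by a finite measure restores countable
    additivity. *)

Section calculus.
Context {R : realType}.
Implicit Types (g h : R -> R) (x y l : R).

Lemma unit_itvP x : unit_itv x <-> 0 <= x <= 1.
Proof. by rewrite /unit_itv /= in_itv. Qed.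

Lemma unit0 : unit_itv (0 : R). Proof. by apply/unit_itvP; rewrite lexx ler01. Qed.
Lemma unit1 : unit_itv (1 : R). Proof. by apply/unit_itvP; rewrite lexx ler01. Qed.

(** This makes the limit in [derive01] unique, also at 0 and 1. A step of length at most 1/2 stays
    in [0,1] when taken to the right from [x <= 1/2] and to the left otherwise. *)
Lemma proper_within_dnbhs x : unit_itv x -> ProperFilter (within unit_itv x^').
Proof.
move=> /unit_itvP x01; apply: Build_ProperFilter_ex => P.
rewrite /within /= => /nbhs_ballP[e /= e0 He].
have [t [t0 te t1]] : exists t, [/\ 0 < t, t < e & t <= 1/2].
  exists (Num.min (e/2) (1/2)); split.
  - by rewrite lt_min !divr_gt0.
  - by rewrite gt_min ltr_pdivrMr// ltr_pMr// ltr1n.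
  - by rewrite ge_min lexx orbT.
have [xl|xl] := leP x (1/2).
- exists (x + t); apply: (He (x + t)).
  + by rewrite /ball /= ltr_norml; lra.
  + by apply/eqP; lra.
  + by apply/unit_itvP; lra.
- exists (x - t); apply: (He (x - t)).
  + by rewrite /ball /= ltr_norml; lra.
  + by apply/eqP; lra.
  + by apply/unit_itvP; lra.
Qed.

Definition has_derive01 g x l :=
  diff_quotient g x y @[y --> within unit_itv x^'] --> l.

Lemma derive01_unique g x l : unit_itv x -> has_derive01 g x l ->
  derive01 g x = l.
Proof.
by move=> x01 gl; have := proper_within_dnbhs x01 => ?; exact: (cvg_lim _ gl).
Qed.

Lemma has_derive01P g x : derivable01 g x -> has_derive01 g x (derive01 g x).
Proof. by []. Qed.

Lemma cvg_within01P g x l : g @ within unit_itv (nbhs x) --> l <->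
  forall A, nbhs l A -> \forall y \near x, unit_itv y -> A (g y).
Proof. by []. Qed.

Lemma has_derive01E g x l : has_derive01 g x l <->
  forall A, nbhs l A ->
    \forall y \near x, y != x -> unit_itv y -> A (diff_quotient g x y).
Proof. by []. Qed.

(** Caratheodory's form of differentiability. The chain rule then multiplies two slope functions and
    never divides by [h y - h x], which may vanish. *)
Lemma caratheodory01 g x l : has_derive01 g x l ->
  exists2 p : R -> R, p @ within unit_itv (nbhs x) --> p x &
    p x = l /\ forall y, g y - g x = p y * (y - x).
Proof.
move=> gl; exists (fun y => if y == x then l else diff_quotient g x y).
- rewrite eqxx; apply/cvg_within01P => A lA.
  apply: filterS ((has_derive01E _ _ _).1 gl _ lA) => y h yI; case: eqP => [_|/eqP yx].
    exact: nbhs_singleton.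
  exact: h.
- rewrite eqxx; split => // y; case: eqP => [->|/eqP yx].
    by rewrite !subrr mulr0.
  by rewrite /diff_quotient divfK// subr_eq0.
Qed.

Lemma caratheodory01_inv g x (p : R -> R) :
  p @ within unit_itv (nbhs x) --> p x ->
  (forall y, unit_itv y -> g y - g x = p y * (y - x)) ->
  has_derive01 g x (p x).
Proof.
move=> /cvg_within01P px gp; apply/has_derive01E => A lA.
apply: filterS (px _ lA) => y h yx yI; rewrite /diff_quotient gp// mulfK ?subr_eq0//.
exact: h.
Qed.

Lemma has_derive01_cvg g x l : has_derive01 g x l ->
  g @ within unit_itv (nbhs x) --> g x.
Proof.
move=> /caratheodory01[p px [_ gp]].
have : (fun y => g x + p y * (y - x)) @ within unit_itv (nbhs x)
    --> g x + p x * (x - x).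
  apply: cvgD; first exact: cvg_cst.
  apply: cvgM => //; apply: cvgB; last exact: cvg_cst.
  exact: cvg_within.
have -> : (fun y => g x + p y * (y - x)) = g.
  by apply/funext => y; rewrite -gp addrC subrK.
by rewrite subrr mulr0 addr0.
Qed.

Lemma has_derive01_comp g h x a b : (forall y, unit_itv y -> unit_itv (h y)) ->
  unit_itv x -> has_derive01 h x b -> has_derive01 g (h x) a ->
  has_derive01 (g \o h) x (a * b).
Proof.
move=> hI x01 dh /caratheodory01[p px [pa gp]].
have hc := has_derive01_cvg dh.
move: dh => /caratheodory01[r rx [rb hr]].
rewrite -pa -rb; apply: (@caratheodory01_inv _ _ (fun y => p (h y) * r y)).
- apply: cvgM => //.
  apply: (cvg_comp _ _ _ px) => A hA.
  have := (cvg_within01P _ _ _).1 hc _ hA.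
  by apply: filterS => y + yI; apply => //; exact: hI.
- by move=> y yI /=; rewrite gp hr mulrA.
Qed.

End calculus.

(** * C1 maps of [0,1] with nonvanishing derivative *)

Section regular_maps.
Context {R : realType}.
Implicit Types (g h : R -> R) (x y l : R).

Definition regular01 g := [/\ forall x, unit_itv x -> unit_itv (g x),
  C1_01 g & forall x, unit_itv x -> derive01 g x != 0].

Lemma C1_01_has g x : C1_01 g -> unit_itv x -> has_derive01 g x (derive01 g x).
Proof. by move=> [dg _] /dg/has_derive01P. Qed.

Lemma C1_01_continuous g : C1_01 g -> {within unit_itv, continuous g}.
Proof.
move=> Cg; apply/subspace_continuousP => x xI.
exact: has_derive01_cvg (C1_01_has Cg xI).
Qed.

(** At interior points the restriction of the limit to [0,1] has no effect. This gives access to the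
    mean value theorem and the fundamental theorem of calculus, which ask for derivatives only in
    the interior. *)
Lemma C1_01_is_derive g x : C1_01 g -> 0 < x < 1 ->
  is_derive x (1 : R) g (derive01 g x).
Proof.
move=> Cg x01; have xI : unit_itv x by apply/unit_itvP; lra.
have [p px [pl gp]] := caratheodory01 (C1_01_has Cg xI).
apply/is_derive1_caratheodory; exists p; split => //.
move=> A /= pA; have := (cvg_within01P _ _ _).1 px _ pA.
have : \forall y \near x, unit_itv y.
  have : x \in `]0, 1[ by rewrite in_itv.
  move/near_in_itvoo; apply: filterS => y; rewrite in_itv/= => y01.
  by apply/unit_itvP; lra.
by apply: filterS2 => y yI; apply.
Qed.

Lemma has_derive01_id x : has_derive01 id x 1.
Proof.
apply: (@caratheodory01_inv _ _ _ (cst 1)); first exact: cvg_cst.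
by move=> y _; rewrite mul1r.
Qed.

Lemma derive01_id x : unit_itv x -> derive01 id x = 1.
Proof. by move=> xI; exact: derive01_unique (has_derive01_id x). Qed.

Lemma C1_01_id : C1_01 (id : R -> R).
Proof.
split=> [x _|]; first by apply/cvg_ex; exists 1; exact: has_derive01_id.
have E : {in unit_itv, cst 1 =1 derive01 (id : R -> R)}.
  by move=> x /[!inE] xI; rewrite derive01_id.
by apply: (subspace_eq_continuous E); exact: cst_continuous.
Qed.

Lemma C1_01_comp g h : (forall x, unit_itv x -> unit_itv (h x)) ->
  C1_01 g -> C1_01 h -> C1_01 (g \o h).
Proof.
move=> hI Cg Ch.
have dgh x : unit_itv x ->
    has_derive01 (g \o h) x (derive01 g (h x) * derive01 h x).
  move=> xI; apply: has_derive01_comp => //; first exact: C1_01_has.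
  by apply: C1_01_has => //; exact: hI.
split=> [x xI|]; first by apply/cvg_ex; eexists; exact: dgh.
have E : {in unit_itv, (fun x => derive01 g (h x) * derive01 h x) =1
    derive01 (g \o h)}.
  by move=> x /[!inE] xI; rewrite (derive01_unique xI (dgh _ xI)).
apply: (subspace_eq_continuous E).
have /subspace_continuousP cg := Cg.2; have /subspace_continuousP ch := Ch.2.
apply/subspace_continuousP => x xI; apply: cvgM; last exact: ch.
apply/cvg_within01P => B hB.
have := (cvg_within01P _ _ _).1 (cg _ (hI _ xI)) _ hB.
move=> /((cvg_within01P _ _ _).1 (has_derive01_cvg (C1_01_has Ch xI))).
by apply: filterS => y + yI; apply => //; exact: hI.
Qed.

Lemma derive01_comp g h x : (forall x, unit_itv x -> unit_itv (h x)) ->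
  C1_01 g -> C1_01 h -> unit_itv x ->
  derive01 (g \o h) x = derive01 g (h x) * derive01 h x.
Proof.
move=> hI Cg Ch xI; apply: derive01_unique => //.
apply: has_derive01_comp => //; first exact: C1_01_has.
by apply: C1_01_has => //; exact: hI.
Qed.

Lemma subitv01 x y : unit_itv x -> unit_itv y ->
  [set` `[x, y]] `<=` (unit_itv : set R).
Proof.
move=> /unit_itvP xI /unit_itvP yI z /=; rewrite in_itv/= => xyz.
by apply/unit_itvP; lra.
Qed.

Lemma MVT01 g x y : C1_01 g -> unit_itv x -> unit_itv y -> x < y ->
  exists2 c, unit_itv c & g y - g x = derive01 g c * (y - x).
Proof.
move=> Cg xI yI xy.
have [||c cxy gc] := @MVT R g (derive01 g) x y xy.
- move=> z; rewrite in_itv /= => xyz; apply: C1_01_is_derive => //.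
  by move: xI yI => /unit_itvP ? /unit_itvP; lra.
- by apply: continuous_subspaceW (C1_01_continuous Cg); exact: subitv01.
- by exists c => //; apply: (subitv01 xI yI); exact: subset_itv_oo_cc cxy.
Qed.

End regular_maps.

Section regular_maps_image.
Context {R : realType}.
Implicit Types (g h : R -> R) (x y l : R).

Lemma regular01_sign g : regular01 g ->
  (forall x, unit_itv x -> 0 < derive01 g x) \/
  (forall x, unit_itv x -> derive01 g x < 0).
Proof.
move=> [_ [_ cg] g0].
have sgn x y : unit_itv x -> unit_itv y -> 0 < derive01 g x -> 0 < derive01 g y.
  move=> xI yI dx; rewrite lt_neqAle eq_sym g0//= leNgt; apply/negP => dy.
  wlog xy : x y xI yI dx dy / x < y => [hw|].
    have [xy|yx|xy] := ltgtP x y; first exact: (hw x y).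
    - have [||c cyx /eqP] := @IVT R (derive01 g) y x 0 (ltW yx).
      + by apply: continuous_subspaceW cg; exact: subitv01.
      + by rewrite ge_min le_max (ltW dx) (ltW dy) orbT.
      + by apply/negP/g0; exact: (subitv01 yI xI).
    - by move: dx; rewrite xy ltNge (ltW dy).
  have [||c cxy /eqP] := @IVT R (derive01 g) x y 0 (ltW xy).
  - by apply: continuous_subspaceW cg; exact: subitv01.
  - by rewrite ge_min le_max (ltW dx) (ltW dy) orbT.
  - by apply/negP/g0; exact: (subitv01 xI yI).
have [d0|d0] := ltP 0 (derive01 g 0); [left|right] => x xI.
  exact: sgn unit0 xI d0.
rewrite lt_neqAle g0//= leNgt; apply/negP => dx.
by have := sgn _ _ xI unit0 dx; rewrite ltNge d0.
Qed.

Lemma regular01_mono g : regular01 g ->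
  (forall x y, unit_itv x -> unit_itv y -> x < y -> g x < g y) \/
  (forall x y, unit_itv x -> unit_itv y -> x < y -> g y < g x).
Proof.
move=> rg; have [_ Cg _] := rg.
case: (regular01_sign rg) => dg; [left|right] => x y xI yI xy.
  by have [c cI E] := MVT01 Cg xI yI xy; rewrite -subr_gt0 E mulr_gt0// ?dg// subr_gt0.
by have [c cI E] := MVT01 Cg xI yI xy; rewrite -subr_lt0 E pmulr_llt0 ?dg// subr_gt0.
Qed.

Lemma regular01_inj g x y : regular01 g -> unit_itv x -> unit_itv y ->
  g x = g y -> x = y.
Proof.
move=> rg xI yI gxy; have [xy|xy|//] := ltgtP x y.
- by case: (regular01_mono rg) => /(_ _ _ xI yI xy); rewrite gxy ltxx.
- by case: (regular01_mono rg) => /(_ _ _ yI xI xy); rewrite gxy ltxx.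
Qed.

Lemma regular01_image_itv g x y : regular01 g -> unit_itv x -> unit_itv y ->
  x <= y ->
  g @` [set` `[x, y]] = [set` `[Num.min (g x) (g y), Num.max (g x) (g y)]].
Proof.
move=> rg xI yI xy; have [_ Cg _] := rg; apply/seteqP; split.
- move=> _ [z /= zxy <-]; have zI := subitv01 xI yI zxy.
  move: zxy; rewrite !in_itv/= ge_min le_max.
  rewrite !le_eqVlt => /andP[/orP[/eqP->|xz] /orP[/eqP->|zy]]; rewrite ?eqxx ?orbT//.
  by case: (regular01_mono rg) => mg; rewrite (mg x z)// (mg z y)// ?orbT.
- move=> v /=; rewrite in_itv/= => vxy.
  have [|//|c cxy gc] := @IVT R g x y v xy.
    by apply: continuous_subspaceW (C1_01_continuous Cg); exact: subitv01.
  by exists c.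
Qed.

End regular_maps_image.

(** * Lengths of image intervals and integrals of the derivative *)

Section change_of_variables.
Local Open Scope ereal_scope.
Context {R : realType}.
Implicit Types (g h : R -> R) (x y l : R).
Local Notation mu := (@lebesgue_measure R).

Lemma regular01_lebesgue_itv g x y : regular01 g -> unit_itv x -> unit_itv y ->
  (x <= y)%R -> mu (g @` [set` `[x, y]%R]) = `|g y - g x|%:E.
Proof.
move=> rg xI yI xy; rewrite (regular01_image_itv rg)// lebesgue_measure_itv/= lte_fin.
case: (leP (g x) (g y)) => gxy.
- rewrite ger0_norm ?subr_ge0//; case: ltP => [_|gyx]; first by rewrite -EFinB.
  by rewrite (le_anti (_ : (g x <= g y <= g x)%R)) ?gxy// subrr.
- by rewrite gxy ltr0_norm ?subr_lt0// opprB -EFinB.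
Qed.

(** The factor [k] will be 1 or -1, the sign of the derivative, so that [k * derive01 g] is its
    absolute value. *)
Lemma C1_01_FTC g x y k : C1_01 g -> unit_itv x -> unit_itv y -> (x <= y)%R ->
  \int[mu]_(z in [set` `[x, y]%R]) (k * derive01 g z)%:E =
  (k * (g y - g x))%:E.
Proof.
move=> Cg xI yI; rewrite le_eqVlt => /orP[/eqP->|xy].
  by rewrite subrr mulr0 set_itv1 integral_set1.
have cg := continuous_subspaceW (subitv01 xI yI) (C1_01_continuous Cg).
have dg z : z \in `]x, y[%R -> is_derive z (1%R : R) g (derive01 g z).
  rewrite in_itv/= => zxy; apply: C1_01_is_derive => //.
  by move: xI yI => /unit_itvP ? /unit_itvP; lra.
have ck : {within `[x, y], continuous (fun z => k * g z)%R}.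
  by move=> z; apply: continuousM; [exact: cst_continuous|exact: cg].
rewrite (@continuous_FTC2 R _ (fun z => k * g z)%R)//.
- by rewrite -EFinB mulrBr.
- move=> z; apply: continuousM; first exact: cst_continuous.
  by apply: continuous_subspaceW Cg.2 z; exact: subitv01.
- have /(continuous_within_itvP _ xy)[_ c1 c2] := ck; split => // z zxy.
  by have ? := dg z zxy; apply: derivableM.
- move=> z zxy; have ? := dg z zxy; rewrite derive1E deriveM//.
  by rewrite derive_cst scaler0 addr0 derive_val.
Qed.

Lemma regular01_integral_itv g x y : regular01 g -> unit_itv x -> unit_itv y ->
  (x <= y)%R ->
  \int[mu]_(z in [set` `[x, y]%R]) `|derive01 g z|%:E = `|g y - g x|%:E.
Proof.
move=> rg xI yI xy; have [_ Cg _] := rg; move: (xy); rewrite le_eqVlt => /orP[/eqP ->|sxy].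
  by rewrite subrr normr0 set_itv1 integral_set1.
have [c cI E] := MVT01 Cg xI yI sxy.
case: (regular01_sign rg) => dg.
- rewrite -[RHS]/(EFin _) [in RHS]ger0_norm; last first.
    by rewrite E mulr_ge0 ?subr_ge0// ltW// dg.
  rewrite -[in RHS](mul1r (g y - g x)%R) -C1_01_FTC//.
  apply: eq_integral => z /[!inE] zxy; rewrite mul1r gtr0_norm// dg//.
  exact: (subitv01 xI yI).
- rewrite ler0_norm; last first.
    by rewrite E mulr_le0_ge0 ?subr_ge0// ltW// dg.
  rewrite -mulN1r -C1_01_FTC//.
  apply: eq_integral => z /[!inE] zxy; rewrite mulN1r ltr0_norm// dg//.
  exact: (subitv01 xI yI).
Qed.

End change_of_variables.

(** * Change of variables *)

Section image_measure.
Context {R : realType}.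
Local Open Scope ereal_scope.
Implicit Types g : R -> R.
Local Notation mu := (@lebesgue_measure R).
Local Notation borelR := (measurableTypeR R).

(** Injectivity on [0,1] makes images commute with complements, so the sets with Borel image form a
    sigma-algebra. It contains the rays [[x, +oo[], which generate the Borel sets and whose traces
    on [0,1] are mapped to closed intervals or to the empty set. *)
Lemma regular01_measurable_image g (A : set borelR) : regular01 g ->
  measurable A -> measurable (g @` (A `&` unit_itv) : set borelR).
Proof.
move=> rg mA.
have mgI : measurable (g @` unit_itv : set borelR).
  by rewrite /unit_itv (regular01_image_itv rg unit0 unit1).
suff : (measurable : set (set borelR)) `<=`
    [set A | measurable (g @` (A `&` unit_itv) : set borelR)] by exact.
rewrite [X in X `<=` _](_ : _ = (@ocitv R).-sigma.-measurable)//.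
rewrite [X in X `<=` _]RGenCInfty.measurableE; apply: smallest_sub; last first.
- move=> _ [x ->] /=.
  have [x1|x1] := leP x 1%R; last first.
    rewrite [X in measurable X](_ : _ = set0)// -subset0 => _ [y [/= + /unit_itvP +] _].
    by rewrite in_itv/=; lra.
  have mI : unit_itv (Num.max x 0%R).
    by apply/unit_itvP; rewrite le_max lexx orbT ge_max x1 ler01.
  rewrite (_ : `[x, +oo[%classic `&` _ = [set` `[Num.max x 0%R, 1%R]]).
    rewrite (regular01_image_itv rg mI unit1)//.
    by move/unit_itvP : mI => /andP[].
  apply/seteqP; split=> y /=.
    by rewrite !in_itv/= andbT => -[xy /unit_itvP/andP[y0 y1]]; rewrite ge_max xy y0.
  rewrite !in_itv/= andbT ge_max => /andP[/andP[xy y0] y1].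
  by split => //; apply/unit_itvP/andP.
- split => /=.
  + by rewrite set0I image_set0.
  + move=> B mB; rewrite setTD.
    rewrite [X in measurable X](_ : _ = g @` unit_itv `\` g @` (B `&` unit_itv)).
      exact: measurableD.
    apply/seteqP; split=> [_ [x [/= nBx xI] <-]|_ [/= [x xI <-]] nB].
      split; first by exists x.
      move=> [y [By yI]] gxy; apply: nBx.
      by rewrite -(regular01_inj rg yI xI gxy).
    by exists x => //; split => // Bx; apply: nB; exists x.
  + move=> F mF; rewrite setI_bigcupl image_bigcup.
    exact: bigcupT_measurable.
Qed.

Section def.
Variables (m : {measure set borelR -> \bar R}) (g : R -> R) (rg : regular01 g).

(** The pullback of [m] under [g]. The regularity proof is part of the term, so that the measure
    structure can be inferred from [image_measure rg]. *)
Definition image_measure of regular01 g : set borelR -> \bar R :=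
  fun A => m (g @` (A `&` unit_itv)).

Let im0 : image_measure rg set0 = 0.
Proof. by rewrite /image_measure set0I image_set0 measure0. Qed.

Let im_ge0 A : 0 <= image_measure rg A.
Proof. exact: measure_ge0. Qed.

Let im_sigma_additive : semi_sigma_additive (image_measure rg).
Proof.
move=> F mF tF mUF; rewrite /image_measure setI_bigcupl image_bigcup.
apply: measure_semi_sigma_additive.
- by move=> i; exact: regular01_measurable_image.
- apply/trivIsetP => i j _ _ ij; rewrite -subset0 => y.
  move=> [[x [Fx xI] <-] [z [Fz zI]]] /(regular01_inj rg zI xI) zx.
  move/trivIsetP : tF => /(_ i j I I ij); rewrite -subset0 => /(_ x) [].
  by split => //; rewrite -zx.
- by apply: bigcupT_measurable => i; exact: regular01_measurable_image.
Qed.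

HB.instance Definition _ :=
  isMeasure.Build _ _ _ (image_measure rg) im0 im_ge0 im_sigma_additive.

End def.

Definition abs_deriv g : borelR -> \bar R :=
  (fun x => `|derive01 g x|%:E) \_ unit_itv.

Lemma abs_deriv_ge0 g x : 0 <= abs_deriv g x.
Proof. by rewrite /abs_deriv patchE; case: ifPn. Qed.

Lemma measurable_abs_deriv g : C1_01 g -> measurable_fun (setT : set borelR) (abs_deriv g).
Proof.
move=> [_ cg]; apply/(measurable_restrictT _ measurable_unit_itv)/measurable_EFinP.
apply: measurableT_comp => //.
apply: subspace_continuous_measurable_fun => //; exact: measurable_unit_itv.
Qed.

Lemma integral_abs_deriv (m : {measure set borelR -> \bar R}) g A :
  \int[m]_(x in A) abs_deriv g x =
  \int[m]_(x in A `&` unit_itv) `|derive01 g x|%:E.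
Proof. by rewrite integral_mkcondr. Qed.

Section density.
Variables (m : {measure set borelR -> \bar R}) (g : R -> R) (Cg : C1_01 g).

Definition deriv_measure of C1_01 g : set borelR -> \bar R :=
  fun A => \int[m]_(x in A) abs_deriv g x.

Let dm0 : deriv_measure Cg set0 = 0.
Proof. by rewrite /deriv_measure integral_set0. Qed.

Let dm_ge0 A : 0 <= deriv_measure Cg A.
Proof. by apply: integral_ge0 => x _; exact: abs_deriv_ge0. Qed.

Let dm_sigma_additive : semi_sigma_additive (deriv_measure Cg).
Proof.
apply: semi_sigma_additive_nng_induced; last exact: abs_deriv_ge0.
exact: measurable_abs_deriv.
Qed.

HB.instance Definition _ :=
  isMeasure.Build _ _ _ (deriv_measure Cg) dm0 dm_ge0 dm_sigma_additive.

End density.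

(** Both sides are measures in [A]. Rays form a generating family stable under intersection, and on
    a ray, cut down to an interval with ends x and y, both sides equal [|g y - g x|]. *)
Lemma regular01_change_of_variables g (A : set borelR) : regular01 g ->
  measurable A ->
  mu (g @` (A `&` unit_itv)) = \int[mu]_(x in A `&` unit_itv) `|derive01 g x|%:E.
Proof.
move=> rg mA; have [_ Cg _] := rg.
rewrite -integral_abs_deriv -[LHS]/(image_measure mu rg A) -[RHS]/(deriv_measure mu Cg A).
have := @measure_unique _ R borelR (@RGenCInfty.G R) (fun n => `[- n%:R, +oo[%classic%R)
  _ _ _ _ (image_measure mu rg) (deriv_measure mu Cg) _ _ A mA; apply => {A mA}.
- exact: RGenCInfty.measurableE.
- move=> _ _ [x ->] [y ->]; exists (Num.max x y).
  by apply/seteqP; split => z /=; rewrite !in_itv/= !andbT ge_max; [case=> -> ->|case/andP].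
- by move=> n; eexists.
- rewrite -subTset => x _; exists (Num.truncn `|x|).+1 => //=.
  rewrite in_itv/= andbT lerNl (le_trans (ler_norm _))// normrN.
  by rewrite ltW// truncnS_gt.
- move=> _ [x ->]; rewrite /= /image_measure /deriv_measure integral_abs_deriv.
  have [x1|x1] := leP x 1%R; last first.
    rewrite (_ : _ `&` _ = set0); first by rewrite image_set0 measure0 integral_set0.
    rewrite -subset0 => y [/= + /unit_itvP +].
    by rewrite in_itv/=; lra.
  have mI : unit_itv (Num.max x 0%R).
    by apply/unit_itvP; rewrite le_max lexx orbT ge_max x1 ler01.
  rewrite (_ : _ `&` _ = [set` `[Num.max x 0%R, 1%R]]).
    have m1 : (Num.max x 0 <= 1)%R by move/unit_itvP : mI => /andP[].
    by rewrite regular01_lebesgue_itv//= ?regular01_integral_itv//; exact: unit1.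
  apply/seteqP; split=> y /=.
    by rewrite !in_itv/= andbT => -[xy /unit_itvP/andP[y0 y1]]; rewrite ge_max xy y0.
  rewrite !in_itv/= andbT ge_max => /andP[/andP[xy y0] y1].
  by split => //; apply/unit_itvP/andP.
- move=> n; rewrite /= /image_measure.
  apply: (@le_lt_trans _ _ (mu (g @` unit_itv))).
    apply: le_measure; rewrite ?inE.
    + exact: regular01_measurable_image.
    + by rewrite -(setTI unit_itv); exact: regular01_measurable_image.
    + by apply: image_subset => x [].
  by rewrite /unit_itv regular01_lebesgue_itv ?ltry//; [exact: unit0|exact: unit1].
Qed.

End image_measure.

(** * Words and codings *)

Section words.
Context {R : realType}.
Implicit Types (f : nat -> R -> R) (w u v : seq nat) (a b : nat -> nat) (x y : R).

Lemma regular01_comp (g h : R -> R) :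
  regular01 g -> regular01 h -> regular01 (g \o h).
Proof.
move=> [gI Cg g0] [hI Ch h0]; split; first by move=> x /hI/gI.
  exact: C1_01_comp.
by move=> x xI; rewrite derive01_comp// mulf_neq0 ?h0 ?g0//; exact: hI.
Qed.

Lemma regular01_id : regular01 (id : R -> R).
Proof.
by split; [by []|exact: C1_01_id|move=> x /derive01_id ->; exact: oner_neq0].
Qed.

Lemma word_map_cat f u v : word_map f (u ++ v) = word_map f u \o word_map f v.
Proof. by apply/funext => x; rewrite /word_map foldr_cat. Qed.

Lemma regular01_word f w : (forall i, regular01 (f i)) ->
  regular01 (word_map f w).
Proof.
move=> rf; elim: w => [|i w IH]; first exact: regular01_id.
exact: regular01_comp (rf i) IH.
Qed.

Lemma mkseq_cons (a : nat -> nat) n :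
  mkseq a n.+1 = a 0%N :: mkseq (fun k => a k.+1) n.
Proof. by rewrite /mkseq /= (iotaDl 1) -map_comp. Qed.

Lemma mkseq_cat (a : nat -> nat) n m :
  mkseq a (n + m) = mkseq a n ++ mkseq (fun k => a (n + k)%N) m.
Proof.
by rewrite /mkseq iotaD map_cat add0n -[in iota n m](addn0 n) iotaDl -map_comp.
Qed.

End words.

(** * Uniform exponential contraction of word maps *)

Section contraction.
Context {R : realType} (d : R) (f : nat -> R -> R).
Hypotheses (d1 : 1 < d) (Gf : decaying_gauss_like d f).
Implicit Types (w u v : seq nat) (a b : nat -> nat) (x y : R).

Lemma gauss_regular i : regular01 (f i).
Proof.
split; [exact: gauss_maps Gf i|exact: gauss_C1 Gf i|move=> x xI].
have [C1 [C2 [C10 C20 /(_ i)[xi [la [dxi [C1xi _ _]]]]]]] := gauss_regularity Gf ltr01.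
rewrite -normr_gt0; have /andP[+ _] := dxi _ xI; apply: lt_le_trans.
by apply: lt_le_trans C1xi; rewrite divr_gt0// powR_gt0.
Qed.

Lemma gauss_word w : regular01 (word_map f w).
Proof. exact/regular01_word/gauss_regular. Qed.

Lemma gauss_word_unit w x : unit_itv x -> unit_itv (word_map f w x).
Proof. by have [+ _ _] := gauss_word w; exact. Qed.

Lemma gauss_word_C1 w : C1_01 (word_map f w).
Proof. by have [] := gauss_word w. Qed.

Lemma gauss_derive_cat u v x : unit_itv x ->
  derive01 (word_map f (u ++ v)) x =
  derive01 (word_map f u) (word_map f v x) * derive01 (word_map f v) x.
Proof.
move=> xI; rewrite word_map_cat derive01_comp//.
- by move=> y; exact: gauss_word_unit.
- exact: gauss_word_C1.
- exact: gauss_word_C1.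
Qed.

Lemma gauss_derive_bounded : exists2 L : R, 1 <= L &
  forall i x, unit_itv x -> `|derive01 (f i) x| <= L.
Proof.
(* Regularity with epsilon = d - 1 bounds the derivative of the i-th map by C2/(i+1), hence by C2
   for all digits together. *)
have d10 : 0 < d - 1 by rewrite subr_gt0.
have [C1 [C2 [_ C20 H]]] := gauss_regularity Gf d10.
exists (Num.max 1 C2); first by rewrite le_max lexx.
move=> i x xI; have [xi [la [/(_ _ xI)/andP[_ dla] [_ _ laC]]]] := H i.
apply: (le_trans dla); apply: (le_trans laC).
rewrite subKr powRr1// le_max; apply/orP; right.
by rewrite ler_pdivrMr// ler_pMr// ler1n.
Qed.

Lemma gauss_exponential_contraction : exists K r : R,
  [/\ 0 < K, 0 < r, r < 1 & forall w x, unit_itv x ->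
    `|derive01 (word_map f w) x| <= K * r ^+ size w].
Proof.
have [L L1 HL] := gauss_derive_bounded.
have [q [rho [q0 rho0 rho1 Hq]]] := gauss_contraction Gf.
have L0 : 0 < L by exact: lt_le_trans L1.
pose r := rho `^ (q%:R^-1).
have r0 : 0 < r by exact: powR_gt0.
have rq : r ^+ q = rho.
  rewrite -powR_mulrn ?ltW// -powRrM mulVf ?powRr1 ?ltW//.
  by rewrite pnatr_eq0 -lt0n.
have r1 : r < 1.
  rewrite ltNge; apply/negP => r1.
  by move: rho1; rewrite -rq ltNge exprn_ege1.
(* Each full block of [q] letters contributes [rho = r ^+ q]. Fewer than [q] remaining letters
   contribute at most [L ^+ q], and dividing by [rho] compensates for their power of [r], which is
   at least [rho]. *)
exists (L ^+ q / rho), r; split => //; first by rewrite divr_gt0// exprn_gt0.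
move=> w; move: {2}(size w) (leqnn (size w)) => n.
elim: n w => [|n IH] w wn x xI.
  move: wn; rewrite leqn0 => /nilP ->; rewrite (derive01_id xI) normr1 expr0 mulr1.
  by rewrite ler_pdivlMr// mul1r (le_trans (ltW rho1))// exprn_ege1.
have [wq|qw] := ltnP (size w) q.
  have wL : `|derive01 (word_map f w) x| <= L ^+ size w.
    elim: w {wn wq} => [|i w IHw]; first by rewrite (derive01_id xI) normr1.
    rewrite -cat1s gauss_derive_cat// normrM exprS ler_pM// HL//.
    exact: gauss_word_unit.
  apply: (le_trans wL); rewrite -mulrA.
  apply: (@le_trans _ _ (L ^+ q)); first by rewrite ler_weXn2l// ltnW.
  apply: ler_peMr; first by rewrite exprn_ge0// ltW.
  rewrite [leRHS]mulrC -rq ler_pdivlMr ?exprn_gt0// mul1r.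
  by rewrite ler_wiXn2l ?ltW// ltnW.
rewrite -(cat_take_drop q w) gauss_derive_cat// normrM size_cat exprD.
have sq : size (take q w) = q by rewrite size_takel.
rewrite sq rq mulrCA ler_pM//.
  by have /andP[] := Hq _ _ sq (gauss_word_unit (drop q w) xI).
apply: IH => //; rewrite size_drop leq_subLR (leq_trans wn)//.
by rewrite -add1n leq_add2r.
Qed.

Lemma gauss_diameter : exists K r : R, [/\ 0 < K, 0 < r, r < 1,
  (forall w x, unit_itv x -> `|derive01 (word_map f w) x| <= K * r ^+ size w) &
  (forall w x y, unit_itv x -> unit_itv y ->
    `|word_map f w x - word_map f w y| <= K * r ^+ size w)].
Proof.
have [K [r [K0 r0 r1 H]]] := gauss_exponential_contraction.
exists K, r; split => // w x y xI yI.
wlog xy : x y xI yI / x < y => [hw|].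
  have [xy|xy|->] := ltgtP x y; first exact: hw.
    by rewrite distrC; exact: hw.
  by rewrite subrr normr0 mulr_ge0 ?exprn_ge0 ?ltW.
rewrite distrC; have [c cI ->] := MVT01 (gauss_word_C1 w) xI yI xy.
rewrite normrM (le_trans _ (H w c cI))// ler_piMr// ger0_norm ?subr_ge0 ?(ltW xy)//.
by move: xI yI => /unit_itvP ? /unit_itvP; lra.
Qed.

Lemma gauss_word_distortion : exists2 kappa : R, 1 <= kappa &
  forall w x y, unit_itv x -> unit_itv y ->
    `|derive01 (word_map f w) x| <= kappa * `|derive01 (word_map f w) y|.
Proof.
have [k k1 H] := gauss_distortion Gf; exists k => // -[|i w] x y xI yI.
  by rewrite !(derive01_id _) ?normr1 ?mulr1.
exact: H.
Qed.

End contraction.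

(** * The coding map and its countable exceptional set *)

Section coding.
Context {R : realType} (d : R) (f : nat -> R -> R).
Hypotheses (d1 : 1 < d) (Gf : decaying_gauss_like d f).
Implicit Types (w u v : seq nat) (a b : nat -> nat) (x y : R).

Lemma exp_small (K r e : R) : 0 < K -> 0 < r -> r < 1 -> 0 < e ->
  exists n : nat, forall m, (n <= m)%N -> K * r ^+ m < e.
Proof.
move=> K0 r0 r1 e0.
have : K * r ^+ n @[n --> \oo] --> 0.
  rewrite -[X in _ --> X](mulr0 K); apply: cvgM; first exact: cvg_cst.
  by apply: cvg_expr; rewrite gtr0_norm.
move=> /cvgrPdist_lt/(_ _ e0)[n _ H]; exists n => m nm.
have := H m nm; rewrite sub0r normrN; apply: le_lt_trans; exact: ler_norm.
Qed.

Lemma coding_cvg a :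
  word_map f (mkseq a n) 1 @[n --> \oo] --> coding f a.
Proof.
have [K [r [K0 r0 r1 _ diam]]] := gauss_diameter d1 Gf.
suff : cvg (word_map f (mkseq a n) 1 @[n --> \oo]) by [].
apply/cauchy_cvgP/cauchy_exP => e e0.
have [n Hn] := exp_small K0 r0 r1 e0.
exists (word_map f (mkseq a n) 1); exists n => // m /= nm.
rewrite /ball/= -(subnK nm) addnC mkseq_cat word_map_cat/=.
apply: (le_lt_trans _ (Hn n (leqnn n))).
rewrite -[X in r ^+ X](size_mkseq a n); apply: diam; first exact: unit1.
exact: (gauss_word_unit Gf _ unit1).
Qed.

Lemma coding_in_cylinder a n :
  (word_map f (mkseq a n) @` unit_itv) (coding f a).
Proof.
have rw := gauss_word Gf (mkseq a n).
rewrite /unit_itv (regular01_image_itv rw unit0 unit1)//.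
have cl := @interval_closed R (BLeft (Num.min (word_map f (mkseq a n) 0)
  (word_map f (mkseq a n) 1))) (BRight (Num.max (word_map f (mkseq a n) 0)
  (word_map f (mkseq a n) 1))) erefl erefl.
apply: (closed_cvg _ cl _ _ (@coding_cvg a)).
exists n => // m /= nm.
suff : (word_map f (mkseq a n) @` unit_itv) (word_map f (mkseq a m) 1).
  by rewrite /unit_itv (regular01_image_itv rw unit0 unit1).
rewrite -(subnK nm) addnC mkseq_cat word_map_cat/=.
by eexists; last reflexivity; exact: (gauss_word_unit Gf _ unit1).
Qed.

Lemma coding_unit a : unit_itv (coding f a).
Proof. by have [x xI <-] := coding_in_cylinder a 0. Qed.

Lemma coding_unique a x :
  (forall n, (word_map f (mkseq a n) @` unit_itv) x) -> coding f a = x.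
Proof.
have [K [r [K0 r0 r1 _ diam]]] := gauss_diameter d1 Gf.
move=> H; apply/eqP; rewrite -subr_eq0 -normr_eq0 eq_le normr_ge0 andbT.
apply/ler_addgt0Pl => e e0; rewrite addr0.
have [n /(_ n (leqnn n)) Hn] := exp_small K0 r0 r1 e0.
have [y yI <-] := H n; have [z zI <-] := coding_in_cylinder a n.
apply: (le_trans (diam _ _ _ zI yI)).
by rewrite size_mkseq ltW.
Qed.

Lemma coding_cons a : coding f a = f (a 0%N) (coding f (fun k => a k.+1)).
Proof.
apply: coding_unique => n; case: n => [|n].
  exists (f (a 0%N) (coding f (fun k => a k.+1))) => //.
  exact: (gauss_maps Gf) (coding_unit _).
have [y yI yE] := coding_in_cylinder (fun k => a k.+1) n.
by exists y => //; rewrite mkseq_cons /= yE.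
Qed.

Lemma coding_prefix a n :
  coding f a = word_map f (mkseq a n) (coding f (fun k => a (n + k)%N)).
Proof.
elim: n a => [//|n IH] a; rewrite mkseq_cons coding_cons IH//=.
Qed.

Lemma gauss_cover_point x : unit_itv x -> x != 0 ->
  exists i y, unit_itv y /\ f i y = x.
Proof.
move=> xI x0; have : [set` `]0%R, 1%R]] x.
  by rewrite /= in_itv/= lt_neqAle eq_sym x0; exact/unit_itvP.
by rewrite -(gauss_cover Gf) => -[i _ [y yI <-]]; exists i, y.
Qed.

(** The exceptional set of the whole development: cylinders of equal length meet only inside it, and
    every other point of [0,1] has exactly one code. The empty word puts 0 and 1 into it, and it is
    stable under all word maps, so digits can be peeled off by induction without entering it. *)
Definition endpoints : set R :=
  range (fun p : seq nat * bool => word_map f p.1 (if p.2 then 1 else 0)).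

Lemma countable_endpoints : countable endpoints.
Proof. by apply: (sub_countable (card_image_le _ _)); exact: countableP. Qed.

Lemma endpoints_word w x : endpoints x -> endpoints (word_map f w x).
Proof.
by move=> [[u b] _ <-]; exists (w ++ u, b); rewrite ?word_map_cat.
Qed.

Lemma endpoints01 x : unit_itv x -> ~ endpoints x -> 0 < x < 1.
Proof.
move=> /unit_itvP/andP[x0 x1] nx; rewrite !lt_neqAle x0 x1 !andbT.
apply/andP; split; apply/eqP => xE; apply: nx.
  by exists ([::], false).
by exists ([::], true).
Qed.

(** A code is found by choosing a preimage under some [f i] again and again. This never stops: only
    0 lacks a preimage, 0 is an endpoint, and a preimage of a point outside [endpoints] is again
    outside. *)
Lemma attractor_cocountable x : unit_itv x -> ~ endpoints x -> attractor f x.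
Proof.
move=> xI nx.
have /choice[nxt Hnxt] : forall y, exists p : nat * R, unit_itv y /\ ~ endpoints y ->
    [/\ unit_itv p.2, ~ endpoints p.2 & f p.1 p.2 = y].
  move=> y; have [[yI ny]|ny] := pselect (unit_itv y /\ ~ endpoints y); last first.
    by exists (0%N, 0).
  have /andP[y0 _] := endpoints01 yI ny.
  have [||i [z [zI fz]]] := @gauss_cover_point y; [by []|by rewrite gt_eqF|].
  exists (i, z) => _; split => // ez; apply: ny; rewrite -fz.
  exact: (endpoints_word [:: i]).
pose xs n := iter n (fun y => (nxt y).2) x.
pose a n := (nxt (xs n)).1.
have xsP n : unit_itv (xs n) /\ ~ endpoints (xs n).
  by elim: n => [//|n /Hnxt[]].
have xE n : x = word_map f (mkseq a n) (xs n).
  elim: n => [//|n ->]; rewrite -addn1 mkseq_cat word_map_cat/= addn0 addn1.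
  by congr (word_map _ _ _); have [_ _] := Hnxt _ (xsP n).
exists a => //; apply: coding_unique => n; exists (xs n); last by rewrite -xE.
by case: (xsP n).
Qed.

Lemma attractor_unit : attractor f `<=` unit_itv.
Proof. by move=> _ [a _ <-]; exact: coding_unit. Qed.

Lemma images_overlap i j x y : i != j -> unit_itv x -> unit_itv y ->
  f i x = f j y -> x = 0 \/ x = 1 \/ y = 0 \/ y = 1.
Proof.
move=> ij xI yI fxy.
have inner z : unit_itv z -> z <> 0 -> z <> 1 -> z \in `]0, 1[.
  move=> /unit_itvP/andP[z0 z1] /eqP zn0 /eqP zn1.
  by rewrite in_itv/= !lt_neqAle z0 z1 zn1 eq_sym zn0.
apply: contrapT => /not_orP[x0 /not_orP[x1 /not_orP[y0 y1]]].
have := gauss_open_set Gf ij; rewrite -subset0 => /(_ (f i x)); apply; split.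
  by exists x => //=; exact: inner.
by exists y => //=; exact: inner.
Qed.

Lemma images_overlap_endpoints i j x y : i != j -> unit_itv x -> unit_itv y ->
  f i x = f j y -> endpoints (f i x).
Proof.
move=> ij xI yI fxy.
have [->|[->|[y0|y1]]] := images_overlap ij xI yI fxy.
- by exists ([:: i], false).
- by exists ([:: i], true).
- by exists ([:: j], false) => //=; rewrite fxy y0.
- by exists ([:: j], true) => //=; rewrite fxy y1.
Qed.

(** Injectivity strips the common prefix. At the first differing letter the open set condition
    forces one of the two preimages to be 0 or 1, and applying the stripped maps keeps the point in
    [endpoints]. *)
Lemma cylinders_overlap u v x y : size u = size v -> u != v ->
  unit_itv x -> unit_itv y -> word_map f u x = word_map f v y ->
  endpoints (word_map f u x).
Proof.
elim: u v => [|i u IH] [|j v]//= [uv] ne xI yI.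
have uI := gauss_word_unit Gf u xI; have vI := gauss_word_unit Gf v yI.
move: ne; rewrite eqseq_cons negb_and; case: eqVneq => [->/= uv'|ij _].
  move=> /(regular01_inj (gauss_regular Gf j) uI vI) E.
  by apply: (endpoints_word [:: j]); exact: IH uv uv' xI yI E.
exact: images_overlap_endpoints.
Qed.

Lemma uniquely_coded_cocountable x : unit_itv x -> ~ endpoints x ->
  uniquely_coded f x.
Proof.
move=> xI nx; have [a _ ax] := attractor_cocountable xI nx.
exists a; split => // b bx; apply: contrapT => ab; apply: nx.
have [n abn] : exists n, mkseq a n != mkseq b n.
  apply: contrapT => H; apply: ab; apply/funext => k.
  have : mkseq a k.+1 = mkseq b k.+1.
    by apply: contrapT => E; apply: H; exists k.+1; apply/eqP.
  by move=> /(congr1 (fun s => nth 0%N s k)); rewrite !nth_mkseq.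
rewrite -ax (coding_prefix a n).
apply: (cylinders_overlap _ abn _ (coding_unit (fun k => b (n + k)%N))).
- by rewrite !size_mkseq.
- exact: coding_unit.
- by rewrite -!coding_prefix ax bx.
Qed.

End coding.

(** * Countable unions and densities *)

Section countable_unions.
Local Open Scope ereal_scope.
Context d (T : measurableType d) {R : realType} (I : countType).
Variable m : {measure set T -> \bar R}.
Implicit Types (D : set I) (F : I -> set T).

(** Reindexes the family by [nat] through the encoding of the countable type. Numbers that encode no
    element of [D] get the empty set, which changes neither the union nor the sum. *)
Let enum_sets D F (n : nat) : set T :=
  if choice.pickle_inv n is Some i then if i \in D then F i else set0 else set0.

Let enum_sets_pickle D F i :
  enum_sets D F (choice.pickle i) = if i \in D then F i else set0.
Proof. by rewrite /enum_sets choice.pickleK_inv. Qed.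

Let bigcup_enum D F : \bigcup_(i in D) F i = \bigcup_n enum_sets D F n.
Proof.
apply/seteqP; split => x [i Di Fx].
  by exists (choice.pickle i) => //; rewrite enum_sets_pickle mem_set.
move: Fx; rewrite /enum_sets; case: choice.pickle_inv => // j.
by case: ifPn => // /[!inE] Dj Fx; exists j.
Qed.

Let series_enum D F :
  \sum_(n <oo) m (enum_sets D F n) = \esum_(i in D) m (F i).
Proof.
rewrite nneseries_esumT//.
rewrite (eq_esum (b := fun i => m (enum_sets D F (choice.pickle i)))); last first.
  by move=> i Di; rewrite enum_sets_pickle mem_set.
rewrite -(esum_image D choice.pickle (fun n => m (enum_sets D F n))); last first.
  by move=> i j _ _; exact: (pcan_inj choice.pickleK_inv).
rewrite [RHS]esum_mkcond; apply: eq_esum => n _; case: ifPn => //.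
rewrite notin_setE /enum_sets => nn.
case E : choice.pickle_inv => [i|]; last by rewrite measure0.
case: ifPn => [/[!inE] Di|_]; last by rewrite measure0.
exfalso; apply: nn; exists i => //.
by have := choice.pickle_invK (T := I) n; rewrite E.
Qed.

Let measurable_enum D F : (forall i, D i -> measurable (F i)) ->
  forall n, measurable (enum_sets D F n).
Proof.
move=> mF n; rewrite /enum_sets; case: choice.pickle_inv => // i.
by case: ifPn => // /[!inE] Di; exact: mF.
Qed.

Lemma measurable_bigcup_countable D F : (forall i, D i -> measurable (F i)) ->
  measurable (\bigcup_(i in D) F i).
Proof.
move=> mF; rewrite bigcup_enum; apply: bigcupT_measurable.
exact: measurable_enum.
Qed.

Lemma measure_bigcup_esum D F : (forall i, D i -> measurable (F i)) ->
  trivIset D F -> m (\bigcup_(i in D) F i) = \esum_(i in D) m (F i).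
Proof.
move=> mF tF; rewrite bigcup_enum measure_bigcup//.
- by rewrite -series_enum; apply: eq_eseriesl => n; rewrite in_setT.
- by move=> n _; exact: measurable_enum.
- apply/trivIsetP => n k _ _ nk; rewrite -subset0 => x; rewrite /enum_sets => -[].
  case En : choice.pickle_inv => [i|//]; case: ifPn => // /[!inE] Di Fi.
  case Ek : choice.pickle_inv => [j|//]; case: ifPn => // /[!inE] Dj Fj.
  have ij := tF i j Di Dj (ex_intro _ x (conj Fi Fj)).
  have := choice.pickle_invK (T := I) n; have := choice.pickle_invK (T := I) k.
  by rewrite En Ek /= => jk iN; move: nk; rewrite -jk -iN ij eqxx.
Qed.

Lemma le_measure_bigcup_esum D F : (forall i, D i -> measurable (F i)) ->
  m (\bigcup_(i in D) F i) <= \esum_(i in D) m (F i).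
Proof.
move=> mF; rewrite -series_enum; apply: measure_sigma_subadditive.
- exact: measurable_enum.
- exact: measurable_bigcup_countable.
- by rewrite bigcup_enum.
Qed.

End countable_unions.

Section density.
Local Open Scope ereal_scope.
Context d (T : measurableType d) {R : realType}.
Variables m n : {measure set T -> \bar R}.
Variable rho : T -> \bar R.
Hypothesis mrho : measurable_fun setT rho.
Hypothesis rho0 : forall x, 0 <= rho x.
Hypothesis rhofin : forall x, rho x \is a fin_num.
Hypothesis nE : forall A, measurable A -> n A = \int[m]_(x in A) rho x.

Import HBNNSimple.

(** Monotone convergence along simple functions increasing to [f] reduces both sides to indicators,
    where the claim is [nE]. *)
Lemma integral_density f E : (forall x, 0 <= f x) -> measurable E ->
  measurable_fun E f ->
  \int[n]_(x in E) f x = \int[m]_(x in E) (f x * rho x).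
Proof.
move=> f0 mE mf; pose h := nnsfun_approx mE mf.
have hf x : E x -> (EFin \o h k) x @[k --> \oo] --> f x.
  by move=> Ex; exact: cvg_nnsfun_approx.
have -> : \int[n]_(x in E) f x = limn (fun k => \int[n]_(x in E) (h k x)%:E).
  rewrite -monotone_convergence//.
  - by apply: eq_integral => x /[!inE] Ex; apply/esym/cvg_lim => //; exact: hf.
  - by move=> k; apply/measurable_EFinP/measurable_funTS/measurable_funP.
  - by move=> k x Ex; rewrite lee_fin.
  - by move=> x Ex a b ab; rewrite lee_fin; exact/lefP/nd_nnsfun_approx.
have -> : \int[m]_(x in E) (f x * rho x) =
    limn (fun k => \int[m]_(x in E) ((h k x)%:E * rho x)).
  rewrite -monotone_convergence//.
  - apply: eq_integral => x /[!inE] Ex; apply/esym/cvg_lim => //.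
    by apply: cvgeZr; [exact: rhofin|exact: hf].
  - move=> k; apply/emeasurable_funM; apply/measurable_funTS => //.
    exact/measurable_EFinP.
  - by move=> k x Ex; rewrite mule_ge0 ?lee_fin.
  - move=> x Ex a b ab; rewrite lee_wpmul2r ?lee_fin//.
    exact/lefP/nd_nnsfun_approx.
congr (lim (_ @ \oo)); apply/funext => k.
have hE x : (h k x)%:E = \sum_(y \in range (h k)) (y * \1_(h k @^-1` [set y]) x)%:E.
  by rewrite fsumEFin// -fimfunE.
under eq_integral do rewrite hE.
under [RHS]eq_integral do rewrite hE.
have mind r : measurable_fun E (fun x => (r * \1_(h k @^-1` [set r]) x)%:E).
  by apply: (measurable_comp measurableT) => //; exact: measurable_funM.
rewrite ge0_integral_fsum//; last by move=> r x Ex; exact: nnfun_muleindic_ge0.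
under [RHS]eq_integral.
  move=> x Ex; rewrite ge0_mule_fsuml; last first.
    by move=> r; exact: nnfun_muleindic_ge0.
  over.
rewrite ge0_integral_fsum//; last 2 first.
- by move=> r; apply: emeasurable_funM => //; exact: measurable_funTS.
- by move=> r x Ex; rewrite mule_ge0// nnfun_muleindic_ge0.
apply: eq_fsbigr => r rh.
under eq_integral do rewrite EFinM.
rewrite integralZl_indic_nnsfun//.
under [RHS]eq_integral do rewrite EFinM -muleA.
rewrite ge0_integralZl//.
- rewrite integral_indic//.
  rewrite nE; last by apply: measurableI.
  congr (_ * _); rewrite setIC integral_mkcondr; apply: eq_integral => x _.
  by rewrite patchE indicE; case: ifPn => _; rewrite ?mul1e ?mul0e.
- by apply: emeasurable_funM; [exact/measurable_EFinP|exact: measurable_funTS].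
- by move=> x Ex; rewrite mule_ge0// lee_fin.
- by move: rh; rewrite inE => -[x _ <-]; rewrite lee_fin.
Qed.

End density.

(** * The change of variables formula as a property of a measure *)

Section jacobian.
Local Open Scope ereal_scope.
Context {R : realType}.
Implicit Types g h : R -> R.
Local Notation borelR := (measurableTypeR R).
Local Notation lam := (@lebesgue01 R).
Implicit Types m : {measure set borelR -> \bar R}.

(** Conformality of exponent 1 for a single map. Lebesgue measure and an unknown conformal measure
    share it, so the chain rule and the distortion bounds are proved once for both. *)
Definition has_jacobian m g := forall A : set borelR, measurable A ->
  m (g @` (A `&` unit_itv)) = \int[m]_(x in A) abs_deriv g x.

Lemma lebesgue01E (A : set borelR) : A `<=` unit_itv ->
  lam A = lebesgue_measure A.
Proof. by move=> AI; rewrite /lebesgue01/= /mrestr setIidl. Qed.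

Lemma image_unit g (A : set R) : regular01 g -> g @` (A `&` unit_itv) `<=` unit_itv.
Proof. by move=> [gI _ _] _ [x [_ xI] <-]; exact: gI. Qed.

Lemma jacobian_lebesgue g : regular01 g -> has_jacobian lam g.
Proof.
move=> rg A mA; transitivity (lebesgue_measure (g @` (A `&` unit_itv))).
  by apply: lebesgue01E; exact: image_unit.
rewrite regular01_change_of_variables// integral_abs_deriv.
apply: eq_measure_integral => B mB BAI.
by apply/esym/lebesgue01E => x /BAI[].
Qed.

Lemma jacobian_comp m g h : regular01 g -> regular01 h ->
  has_jacobian m g -> has_jacobian m h -> has_jacobian m (g \o h).
Proof.
move=> rg rh jg jh A mA; have [_ Cg _] := rg; have [hI Ch _] := rh.
have mhA := regular01_measurable_image rh mA.
(* Nothing is known about [h] outside [0,1]; its extension by 0 is measurable on the whole line. *)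
pose h' : borelR -> borelR := h \_ unit_itv.
have mh' : measurable_fun (setT : set borelR) h'.
  apply/(measurable_restrictT _ measurable_unit_itv).
  apply: subspace_continuous_measurable_fun; first exact: measurable_unit_itv.
  exact: C1_01_continuous.
have h'E x : unit_itv x -> h' x = h x by move=> xI; rewrite /h' patchE mem_set.
rewrite (_ : (g \o h) @` _ = g @` ((h @` (A `&` unit_itv)) `&` unit_itv)); last first.
  apply/seteqP; split => [_ [x [Ax xI] <-]|_ [y [[x [Ax xI] <-] _] <-]].
    by exists (h x) => //; split; [exists x|exact: hI].
  by exists x.
rewrite jg//.
(* On subsets of [h(A)], [m] is the pushforward under [h'] of its own pullback. The pullback has
   density [|derive01 h|] by [jh], which produces the second factor of the chain rule. *)
transitivity (\int[pushforward (image_measure m rh) h']_(y in h @` (A `&` unit_itv))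
    abs_deriv g y).
  apply: eq_measure_integral => B mB BhA; rewrite /pushforward /= /image_measure.
  congr (m _); apply/seteqP; split => [y By|_ [x [/= h'x xI] <-]].
    have [x [Ax xI] hx] := BhA _ By.
    by exists x => //; split => //=; rewrite h'E// hx.
  by rewrite -h'E.
rewrite ge0_integral_pushforward//; last 2 first.
- by apply: measurable_funTS; exact: measurable_abs_deriv.
- by move=> y _; exact: abs_deriv_ge0.
have mgh : measurable_fun (setT : set borelR) (abs_deriv g \o h').
  by apply: measurableT_comp => //; exact: measurable_abs_deriv.
have mD : measurable (h' @^-1` (h @` (A `&` unit_itv)) : set borelR).
  by rewrite -[X in measurable X]setTI; exact: mh'.
rewrite (@integral_density _ _ _ m _ (abs_deriv h))//; last 5 first.
- exact: measurable_abs_deriv.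
- exact: abs_deriv_ge0.
- by move=> x; rewrite /abs_deriv patchE; case: ifPn.
- by move=> x; exact: abs_deriv_ge0.
- exact: measurable_funTS.
(* The preimage under [h'] may contain points outside [0,1], where [h'] is 0; the integrands of both
   sides vanish there. *)
rewrite integral_mkcond [RHS]integral_mkcond; apply: eq_integral => x _.
rewrite !patchE /=; have [xI|xI] := pselect (unit_itv x); last first.
  have z k : abs_deriv k x = 0 by rewrite /abs_deriv patchE memNset.
  by rewrite !z mule0 !if_same.
have -> : (x \in h' @^-1` (h @` (A `&` unit_itv))) = (x \in A).
  apply/idP/idP; rewrite !inE /= h'E//.
    by move=> [y [Ay yI]] /(regular01_inj rh yI xI) <-.
  by move=> Ax; exists x.
case: ifPn => // _; rewrite h'E// /abs_deriv !patchE !mem_set//; last exact: hI.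
by rewrite derive01_comp// normrM EFinM.
Qed.

Lemma jacobian_id m : has_jacobian m id.
Proof.
move=> A mA; rewrite image_id integral_abs_deriv.
rewrite (eq_integral (cst 1)); last first.
  by move=> x /[!inE] -[_ xI]; rewrite derive01_id// normr1.
by rewrite integral_cst ?mul1e//; apply: measurableI => //; exact: measurable_unit_itv.
Qed.

Lemma jacobian_word m (f : nat -> R -> R) w : (forall i, regular01 (f i)) ->
  (forall i, has_jacobian m (f i)) -> has_jacobian m (word_map f w).
Proof.
move=> rf jf; elim: w => [|i w IH]; first exact: jacobian_id.
by apply: jacobian_comp => //; exact: regular01_word.
Qed.

Lemma jacobian_le m g (A : set borelR) (c : R) : C1_01 g -> has_jacobian m g ->
  measurable A -> (0 <= c)%R ->
  (forall x, unit_itv x -> `|derive01 g x| <= c)%R ->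
  m (g @` (A `&` unit_itv)) <= c%:E * m (A `&` unit_itv).
Proof.
move=> Cg jg mA c0 gc; have mAI := measurableI _ _ mA measurable_unit_itv.
rewrite jg// integral_abs_deriv -integral_cst//.
apply: ge0_le_integral => //.
- have := measurable_funTS (D := A `&` unit_itv) (measurable_abs_deriv Cg).
  by apply: eq_measurable_fun => x /[!inE] -[_ xI]; rewrite /abs_deriv patchE mem_set.
- by move=> x [_ xI]; rewrite lee_fin gc.
Qed.

Lemma jacobian_ge m g (A : set borelR) (c : R) : C1_01 g -> has_jacobian m g ->
  measurable A -> (0 <= c)%R ->
  (forall x, unit_itv x -> c <= `|derive01 g x|)%R ->
  c%:E * m (A `&` unit_itv) <= m (g @` (A `&` unit_itv)).
Proof.
move=> Cg jg mA c0 gc; have mAI := measurableI _ _ mA measurable_unit_itv.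
rewrite jg// integral_abs_deriv -integral_cst//.
apply: ge0_le_integral => //.
- have := measurable_funTS (D := A `&` unit_itv) (measurable_abs_deriv Cg).
  by apply: eq_measurable_fun => x /[!inE] -[_ xI]; rewrite /abs_deriv patchE mem_set.
- by move=> x [_ xI]; rewrite lee_fin gc.
Qed.

End jacobian.

(** * Cylinders and Lebesgue measure *)

Section cylinders.
Local Open Scope ereal_scope.
Context {R : realType} (d : R) (f : nat -> R -> R).
Hypotheses (d1 : (1 < d)%R) (Gf : decaying_gauss_like d f).
Local Notation borelR := (measurableTypeR R).
Local Notation lam := (@lebesgue01 R).
Implicit Types (m : {measure set borelR -> \bar R}) (w u v : seq nat).

Lemma measurable_endpoints : measurable (endpoints f : set borelR).
Proof.
apply: countable_measurable; last exact: countable_endpoints.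
by move=> x; exact: measurable_set1.
Qed.

Lemma lebesgue01_countable (A : set borelR) : countable A -> lam A = 0.
Proof.
move=> cA; apply: countable_lebesgue_measure0.
by apply: sub_countable cA; apply: subset_card_le => x [].
Qed.

Lemma lebesgue01_endpoints : lam (endpoints f) = 0.
Proof. exact/lebesgue01_countable/countable_endpoints. Qed.

Lemma lebesgue01_outside : lam (~` unit_itv) = 0.
Proof. by rewrite /lebesgue01/= /mrestr setICl measure0. Qed.

Lemma lebesgue01_unit : lam unit_itv = 1.
Proof. by rewrite -lebesgue01_setT /lebesgue01/= /mrestr setTI setIid. Qed.

Lemma measure_eq_mod m (N A B : set borelR) : measurable N -> m N = 0 ->
  measurable A -> measurable B ->
  A `\` N `<=` B -> B `\` N `<=` A -> m A = m B.
Proof.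
move=> mN N0 mA mB AB BA.
have le (X Y : set borelR) : measurable X -> measurable Y -> X `\` N `<=` Y -> m X <= m Y.
  move=> mX mY XY; apply: (@le_trans _ _ (m (Y `|` N))).
    apply: le_measure; rewrite ?inE//; first exact: measurableU.
    by move=> x Xx; have [Nx|Nx] := pselect (N x); [right|left; exact: XY].
  by apply: (le_trans (measureU2 m mY mN)); rewrite [X in _ + X]N0 adde0.
by apply/eqP; rewrite eq_le !le.
Qed.

(** Gives Borel measurability of [attractor] and [uniquely_coded], whose definitions quantify over
    all codes: the part of [0,1] that they miss is countable. *)
Lemma measurable_cocountable01 (A : set R) : A `<=` unit_itv ->
  (forall x, unit_itv x -> ~ endpoints f x -> A x) ->
  measurable (A : set borelR).
Proof.
move=> AI HA.
have -> : A = unit_itv `\` (unit_itv `\` A).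
  by rewrite setDD; apply/seteqP; split=> [x Ax|x []//]; split=> //; exact: AI.
apply: measurableD; first exact: measurable_unit_itv.
apply: countable_measurable; first by move=> x; exact: measurable_set1.
apply: (sub_countable _ (countable_endpoints f)); apply: subset_card_le.
by move=> x [xI nA]; apply: contrapT => /(HA _ xI).
Qed.

Lemma lebesgue01_cocountable (A : set R) :
  (forall x, unit_itv x -> ~ endpoints f x -> A x) -> lam (unit_itv `\` A) = 0.
Proof.
move=> HA; apply: lebesgue01_countable.
apply: (sub_countable _ (countable_endpoints f)); apply: subset_card_le.
by move=> x [xI nA]; apply: contrapT => /(HA _ xI).
Qed.

Lemma measurable_attractor : measurable (attractor f : set borelR).
Proof.
apply: measurable_cocountable01; first exact: (attractor_unit d1 Gf).
exact: (attractor_cocountable d1 Gf).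
Qed.

Lemma attractorI : attractor f `&` unit_itv = attractor f.
Proof. by apply: setIidl; exact: (attractor_unit d1 Gf). Qed.

Lemma measurable_word_image w (A : set borelR) : measurable A ->
  measurable (word_map f w @` (A `&` unit_itv) : set borelR).
Proof. by apply: regular01_measurable_image; exact: (gauss_word Gf). Qed.

(** Removing the null set [endpoints] makes the images under distinct words of the same length
    disjoint. *)
Lemma measure_word_images m n (W : set (seq nat)) (A : set borelR) :
  m (endpoints f) = 0 -> measurable A -> (forall w, W w -> size w = n) ->
  m (\bigcup_(w in W) (word_map f w @` (A `&` unit_itv))) =
  \esum_(w in W) m (word_map f w @` (A `&` unit_itv)).
Proof.
move=> mE0 mA Wn; have mE := measurable_endpoints.
have mF w := measurable_word_image w mA.
have mFE w : measurable (word_map f w @` (A `&` unit_itv) `\` endpoints f : set borelR).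
  by apply: measurableD; [exact: mF|exact: mE].
rewrite (measure_eq_mod (B := \bigcup_(w in W)
  ((word_map f w @` (A `&` unit_itv)) `\` endpoints f)) mE mE0); last 4 first.
- by apply: measurable_bigcup_countable => w _; exact: mF.
- by apply: measurable_bigcup_countable => w _; exact: mFE.
- by move=> x [[w Ww Fx] nE]; exists w.
- by move=> x [[w Ww [Fx _]] nE]; exists w.
rewrite measure_bigcup_esum//.
  apply: eq_esum => w _; apply: (measure_eq_mod mE mE0).
  - exact: mFE.
  - exact: mF.
  - by move=> x [[]].
  - by [].
move=> u v Wu Wv [_ [[[x [Ax xI] <-] nE] [[y [Ay yI] uv] _]]].
apply/eqP; apply: contrapT => /negP nuv; apply: nE.
by apply: (cylinders_overlap Gf _ nuv xI yI (esym uv)); rewrite (Wn u) ?(Wn v).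
Qed.

Lemma lebesgue01_words n :
  \esum_(w in [set w : seq nat | size w = n]) lam (word_map f w @` unit_itv) = 1.
Proof.
rewrite -lebesgue01_unit -(setIid unit_itv).
rewrite -(@measure_word_images lam n); last 3 first.
- exact: lebesgue01_endpoints.
- exact: measurable_unit_itv.
- by [].
apply: (measure_eq_mod measurable_endpoints lebesgue01_endpoints).
- apply: measurable_bigcup_countable => w _.
  by apply: measurable_word_image; exact: measurable_unit_itv.
- by rewrite setIid; exact: measurable_unit_itv.
- move=> _ [[w _ [x [xI _] <-]] _]; split; exact: (gauss_word_unit Gf).
- move=> x [[xI _] nx]; have [a _ <-] := attractor_cocountable d1 Gf xI nx.
  exists (mkseq a n); first by rewrite /= size_mkseq.
  by rewrite setIid; exact: (coding_in_cylinder d1 Gf).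
Qed.

(** For an open set [U], the cylinders of length n contained in [U] exhaust its part in the
    attractor as n grows. On the side of [m] their union is bounded by a sum; on the side of [lam],
    for which [endpoints] is null, the sum is the measure of the union. Outer regularity of Lebesgue
    measure then passes from open to Borel sets. *)
Lemma le_lebesgue01_cylinders m (C : R) : (0 <= C)%R ->
  m (~` attractor f) = 0 ->
  (forall w, m (word_map f w @` unit_itv) <= C%:E * lam (word_map f w @` unit_itv)) ->
  forall A : set borelR, measurable A -> m A <= C%:E * lam A.
Proof.
move=> C0 mJ mC A mA.
pose Cl : {measure set borelR -> \bar R} := mscale (NngNum C0) lam.
have CE (X : set borelR) : Cl X = C%:E * lam X by [].
have mJm := measurable_attractor.
have cyl_open (U : set R) : open U -> m U <= C%:E * lam U.
  move=> oU; have mU : measurable (U : set borelR) by exact: open_measurable.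
  pose W n := [set w : seq nat | size w = n /\ word_map f w @` unit_itv `<=` U].
  (* Images of the attractor, not of [0,1], make [V] increase with n: a coded point lies in the
     cylinder extended by its next digit, whereas 0 has no digit to extend with. *)
  pose V n : set borelR := \bigcup_(w in W n) (word_map f w @` attractor f).
  have mV n : measurable (V n).
    apply: measurable_bigcup_countable => w _.
    by rewrite -attractorI; exact: measurable_word_image.
  have JI := attractor_unit d1 Gf.
  have mVC n : m (V n) <= C%:E * lam U.
    rewrite /V -attractorI.
    apply: (@le_trans _ _ (\esum_(w in W n) m (word_map f w @` unit_itv))).
      apply: (le_trans (le_measure_bigcup_esum _ _)).
        by move=> w _; exact: measurable_word_image.
      apply: le_esum => w _; apply: le_measure; rewrite ?inE.
      - exact: measurable_word_image.
      - rewrite -(setIid unit_itv); apply: measurable_word_image.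
        exact: measurable_unit_itv.
      - by apply: image_subset => x [].
    apply: (@le_trans _ _ (\esum_(w in W n) Cl
        (word_map f w @` unit_itv))).
      by apply: le_esum => w _; exact: mC.
    rewrite -{1}(setIid unit_itv) -(@measure_word_images Cl n); last 3 first.
    - by rewrite CE lebesgue01_endpoints mule0.
    - exact: measurable_unit_itv.
    - by move=> w [].
    rewrite -CE; apply: le_measure; rewrite ?inE//.
      apply: measurable_bigcup_countable => w _.
      by apply: measurable_word_image; exact: measurable_unit_itv.
    by move=> x [w [_ wU]]; rewrite setIid => /wU.
  have ndV : nondecreasing_seq V.
    apply/nondecreasing_seqP => n; apply/subsetPset => x.
    move=> [w [wn wU] [_ [a _ <-] <-]].
    exists (w ++ [:: a 0%N]).
      split; first by rewrite size_cat wn addn1.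
      move=> _ [y yI <-]; rewrite word_map_cat; apply: wU.
      by exists (f (a 0%N) y) => //; exact: (gauss_maps Gf).
    exists (coding f (fun k => a k.+1)); first by exists (fun k => a k.+1).
    by rewrite word_map_cat /= -(coding_cons d1 Gf).
  have mVU : m (\bigcup_n V n) <= C%:E * lam U.
    have mbV : measurable (\bigcup_n V n) by exact: bigcupT_measurable.
    have cV := @nondecreasing_cvg_mu _ _ _ m V mV mbV ndV.
    rewrite -(cvg_lim _ cV)//; apply: lime_le; first by apply/cvg_ex; eexists; exact: cV.
    by apply: nearW.
  apply: le_trans mVU.
  apply: (@le_trans _ _ (m (\bigcup_n V n `|` ~` attractor f))).
    apply: le_measure; rewrite ?inE//.
      by apply: measurableU; [exact: bigcupT_measurable|exact: measurableC].
    move=> x Ux; have [[a _ ax]|] := pselect (attractor f x); last by right.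
    left; have [e /= e0 He] := (nbhs_ballP _ _).1 (open_nbhs_nbhs (conj oU Ux)).
    have [K [r [K0 r0 r1 _ diam]]] := gauss_diameter d1 Gf.
    have [n /(_ n (leqnn n)) Hn] := exp_small K0 r0 r1 e0.
    exists n => //; exists (mkseq a n); last first.
      exists (coding f (fun k => a (n + k)%N)); first by eexists.
      by rewrite -(coding_prefix d1 Gf).
    split; first by rewrite size_mkseq.
    move=> _ [y yI <-]; apply: He; rewrite /ball/= -ax (coding_prefix d1 Gf a n).
    apply: le_lt_trans Hn; rewrite -[X in (r ^+ X)%R](size_mkseq a n).
    by apply: diam => //; exact: (coding_unit d1 Gf).
  apply: (le_trans (measureU2 _ _ _)).
  - exact: bigcupT_measurable.
  - exact: measurableC.
  - by rewrite [X in _ + X]mJ adde0.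
have -> : m A = m (A `&` unit_itv).
  apply: (measure_eq_mod (measurableC mJm) mJ) => //.
  - by apply: measurableI => //; exact: measurable_unit_itv.
  - move=> x [Ax /contrapT Jx]; split => //; exact: (attractor_unit d1 Gf).
  - by move=> x [[]].
apply/lee_addgt0Pr => e e0.
have mAI : measurable (A `&` unit_itv : set borelR).
  by apply: measurableI => //; exact: measurable_unit_itv.
have C1 : (0 < C + 1)%R by rewrite ltr_wpDl.
(* The divisor is [C + 1] because [C] may be 0; [C * (e / (C + 1))] is at most [e]. *)
have [|U [oU AU UA]] := @lebesgue_regularity_outer R (A `&` unit_itv) (e / (C + 1)) mAI _ (divr_gt0 e0 C1).
  apply: (@le_lt_trans _ _ (lam setT)); last by rewrite lebesgue01_setT ltry.
  rewrite /lebesgue01/= /mrestr setTI; apply: le_measure; rewrite ?inE//.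
  exact: measurable_unit_itv.
have mU : measurable (U : set borelR) by exact: open_measurable.
apply: (@le_trans _ _ (C%:E * lam U)).
  apply: le_trans (cyl_open _ oU); apply: le_measure; rewrite ?inE//.
apply: (@le_trans _ _ (C%:E * (lam A + (e / (C + 1))%:E))).
  rewrite lee_wpmul2l// /lebesgue01/= /mrestr.
  apply: (@le_trans _ _ (lebesgue_measure ((A `&` unit_itv) `|` (U `\` (A `&` unit_itv))))).
    apply: le_measure; rewrite ?inE//.
    - by apply: measurableI => //; exact: measurable_unit_itv.
    - by apply: measurableU => //; exact: measurableD.
    - move=> x [Ux xI]; have [Ax|Ax] := pselect (A x); first by left.
      by right; split => // -[].
  apply: (le_trans (measureU2 _ _ _)) => //; first exact: measurableD.
  by rewrite leeD2l// ltW.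
rewrite ge0_muleDr ?measure_ge0//; last by rewrite lee_fin divr_ge0 ?ltW.
rewrite leeD2l// -EFinM lee_fin mulrCA ger_pMr// ler_pdivrMr// mul1r.
by rewrite lerDl.
Qed.

End cylinders.

(** * Pressure *)

Section pressure.
Local Open Scope ereal_scope.
Context {R : realType} (d : R) (f : nat -> R -> R).
Hypotheses (d1 : (1 < d)%R) (Gf : decaying_gauss_like d f).
Local Notation lam := (@lebesgue01 R).
Implicit Types (w : seq nat).

Lemma sup_deriv_le w (c : R) :
  (forall x, unit_itv x -> `|derive01 (word_map f w) x| <= c)%R ->
  (sup_deriv (word_map f w) <= c)%R.
Proof.
move=> H; apply: ge_sup; first by exists `|derive01 (word_map f w) 0|%R; exists 0%R => //; exact: unit0.
by move=> _ [x xI <-]; exact: H.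
Qed.

Lemma le_sup_deriv w x : unit_itv x ->
  (`|derive01 (word_map f w) x| <= sup_deriv (word_map f w))%R.
Proof.
move=> xI; have [K [r [_ _ _ H]]] := gauss_exponential_contraction d1 Gf.
apply: ub_le_sup; last by exists x.
by exists (K * r ^+ size w)%R => _ [y yI <-]; exact: H.
Qed.

Lemma sup_deriv_gt0 w : (0 < sup_deriv (word_map f w))%R.
Proof.
apply: (@lt_le_trans _ _ `|derive01 (word_map f w) 0|%R).
  by rewrite normr_gt0; have [_ _] := gauss_word Gf w; apply; exact: unit0.
exact: le_sup_deriv unit0.
Qed.

Lemma sup_deriv_distortion : exists2 kappa : R, (1 <= kappa)%R &
  forall w x, unit_itv x ->
    (sup_deriv (word_map f w) <= kappa * `|derive01 (word_map f w) x|)%R.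
Proof.
have [k k1 H] := gauss_word_distortion Gf; exists k => // w x xI.
by apply: sup_deriv_le => y yI; exact: H.
Qed.

Lemma jacobian_gauss_word w : has_jacobian lam (word_map f w).
Proof. exact/jacobian_lebesgue/(gauss_word Gf). Qed.

Lemma lebesgue01_word_le w (A : set (measurableTypeR R)) : measurable A ->
  lam (word_map f w @` (A `&` unit_itv)) <=
  (sup_deriv (word_map f w))%:E * lam (A `&` unit_itv).
Proof.
move=> mA; apply: jacobian_le => //.
- exact: (gauss_word_C1 Gf).
- exact: jacobian_gauss_word.
- by rewrite ltW// sup_deriv_gt0.
- by move=> x; exact: le_sup_deriv.
Qed.

Lemma lebesgue01_word_ge (kappa : R) w (A : set (measurableTypeR R)) :
  (1 <= kappa)%R ->
  (forall w x, unit_itv x ->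
    (sup_deriv (word_map f w) <= kappa * `|derive01 (word_map f w) x|)%R) ->
  measurable A ->
  (sup_deriv (word_map f w) / kappa)%:E * lam (A `&` unit_itv) <=
  lam (word_map f w @` (A `&` unit_itv)).
Proof.
move=> k1 H mA; have k0 : (0 < kappa)%R by exact: lt_le_trans k1.
apply: jacobian_ge => //.
- exact: (gauss_word_C1 Gf).
- exact: jacobian_gauss_word.
- by rewrite divr_ge0// ltW// sup_deriv_gt0.
- by move=> x xI; rewrite ler_pdivrMr// mulrC; exact: H.
Qed.

Definition word_sum n t : \bar R :=
  \esum_(w in [set w : seq nat | size w = n])
    (sup_deriv (word_map f w) `^ t)%:E.

Lemma le_esumZ (I : choiceType) (D : set I) (a : I -> \bar R) (c : R) :
  (0 <= c)%R -> (forall i, 0 <= a i) ->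
  \esum_(i in D) (c%:E * a i) <= c%:E * \esum_(i in D) a i.
Proof.
move=> c0 a0; apply: ge_ereal_sup => _ [X XD <-].
rewrite -ge0_mule_fsumr// lee_wpmul2l//.
by apply: ereal_sup_ubound; exists X.
Qed.

Lemma word_sum1_ge n : 1 <= word_sum n 1.
Proof.
rewrite -(lebesgue01_words d1 Gf n); apply: le_esum => w _.
rewrite powRr1 ?(ltW (sup_deriv_gt0 _))//.
have := lebesgue01_word_le w (measurable_unit_itv (R := R)).
by rewrite setIid [X in _ <= _ * X]lebesgue01_unit mule1.
Qed.

Lemma word_sum1_le : exists2 kappa : R, (1 <= kappa)%R &
  forall n, word_sum n 1 <= kappa%:E.
Proof.
have [k k1 H] := sup_deriv_distortion; exists k => // n.
have k0 : (0 < k)%R by exact: lt_le_trans k1.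
apply: (@le_trans _ _ (\esum_(w in [set w : seq nat | size w = n])
    (k%:E * lam (word_map f w @` unit_itv)))).
  apply: le_esum => w _; rewrite powRr1 ?(ltW (sup_deriv_gt0 _))//.
  have := lebesgue01_word_ge w k1 H (measurable_unit_itv (R := R)).
  rewrite setIid [X in _ * X <= _]lebesgue01_unit mule1.
  move=> /(lee_wpmul2l (ltW k0 : 0 <= k%:E)); apply: le_trans.
  by rewrite -EFinM mulrC divfK// gt_eqF.
apply: (le_trans (le_esumZ _ (ltW k0) _)) => //.
by rewrite (lebesgue01_words d1 Gf) mule1.
Qed.

(** All pressure bounds compare [word_sum] with exp(a + n b); after division by n only the rate [b]
    survives. The comparisons assume [0 < n], since the inverse of 0 is 0 by convention. *)
Let scaled_affine (a b : R) (n : nat) : R := (n%:R^-1 * (a + n%:R * b))%R.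

Let scaled_affine_cvg a b : (scaled_affine a b n)%:E @[n --> \oo] --> b%:E.
Proof.
apply: cvg_EFin; first by apply: nearW.
rewrite -(cvg_shiftS (scaled_affine a b : R^nat)) /scaled_affine.
have -> : (fun n => n.+1%:R^-1 * (a + n.+1%:R * b))%R = (fun n => harmonic n * a + b)%R.
  by apply/funext => n /=; rewrite mulrDr mulKf// pnatr_eq0.
have : (fun n => harmonic n * a + b)%R @ \oo --> (0 * a + b)%R.
  apply: cvgD; last exact: cvg_cst.
  by apply: cvgM; [exact: cvg_harmonic|exact: cvg_cst].
by rewrite mul0r add0r.
Qed.

Let pressure_seq_le t (a b : R) n : (0 < n)%N ->
  lne (word_sum n t) <= (a + n%:R * b)%:E ->
  pressure_seq f t n <= (scaled_affine a b n)%:E.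
Proof.
move=> n0 H; rewrite /pressure_seq /scaled_affine EFinM.
by apply: lee_wpmul2l => //; rewrite lee_fin.
Qed.

Let pressure_seq_ge t (a b : R) n : (0 < n)%N ->
  (a + n%:R * b)%:E <= lne (word_sum n t) ->
  (scaled_affine a b n)%:E <= pressure_seq f t n.
Proof.
move=> n0 H; rewrite /pressure_seq /scaled_affine EFinM.
by apply: lee_wpmul2l => //; rewrite lee_fin.
Qed.

Lemma pressure_at_one : pressure_is f 1 0.
Proof.
have [k k1 H] := word_sum1_le.
have k0 : (0 < k)%R by exact: lt_le_trans k1.
apply: (@squeeze_cvge _ _ _ _ (fun n => (scaled_affine 0 0 n)%:E) _
   (fun n => (scaled_affine (ln k) 0 n)%:E)); last 2 first.
- exact: scaled_affine_cvg.
- exact: scaled_affine_cvg.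
exists 1%N => // n /= n0; apply/andP; split.
  by apply: pressure_seq_ge => //; rewrite mulr0 addr0 lne_ge0 word_sum1_ge.
apply: pressure_seq_le => //; rewrite mulr0 addr0 -lne_EFin//.
rewrite lee_lne ?in_itv/= ?leey ?andbT ?lee_fin ?(ltW k0)//.
exact: le_trans (word_sum1_ge n).
Qed.

(** With s the supremum of [|f_w'|], write s^t as s^(t-1) s and use s <= K r^n. For t < 1 the first
    factor is at least (K r^n)^(t-1), for t > 1 at most that. As [word_sum n 1] lies between 1 and a
    constant, a zero limit would give (t-1) ln r <= 0 or (t-1) ln r >= 0 respectively, each
    contradicting r < 1. *)
Lemma pressure_zero_unique t : pressure_is f t 0 -> t = 1%R.
Proof.
move=> Pt; have [K [r [K0 r0 r1 H]]] := gauss_exponential_contraction d1 Gf.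
have [k k1 Hk] := word_sum1_le.
have k0 : (0 < k)%R by exact: lt_le_trans k1.
pose D n := (K * r ^+ n)%R.
have D0 n : (0 < D n)%R by rewrite mulr_gt0// exprn_gt0.
have sD w : (sup_deriv (word_map f w) <= D (size w))%R.
  by apply: sup_deriv_le => x; exact: H.
have lnr : (ln r < 0)%R by rewrite ln_lt0// r0.
have lnD n : (ln (D n) = ln K + n%:R * ln r)%R.
  by rewrite lnM ?qualifE//= ?exprn_gt0// lnXn// mulr_natl.
have s1 w : (sup_deriv (word_map f w) `^ t =
    sup_deriv (word_map f w) `^ (t - 1) * sup_deriv (word_map f w))%R.
  rewrite -[X in (_ = _ * X)%R]powRr1 ?(ltW (sup_deriv_gt0 w))//.
  rewrite -powRD ?subrK//; apply/implyP => _.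
  by rewrite gt_eqF// sup_deriv_gt0.
have [t1|t1|//] := ltgtP t 1%R.
- have : ((t - 1) * ln r)%:E <= 0 :> \bar R.
    apply: (lee_cvg_to (@scaled_affine_cvg ((t - 1) * ln K) ((t - 1) * ln r))%R Pt).
    exists 1%N => // n /= n0; apply: pressure_seq_ge => //.
    have Zt : (D n `^ (t - 1))%:E <= word_sum n t.
      (* The power of [D n] is moved to the side of [word_sum n t], which may be infinite for t < 1,
         so that no subtraction or division of extended reals occurs. *)
      have : 1 <= (D n `^ (1 - t))%:E * word_sum n t.
        apply: (le_trans (word_sum1_ge n)).
        apply: le_trans (le_esumZ _ (powR_ge0 _ _) _) => [|w]; last by rewrite lee_fin powR_ge0.
        apply: le_esum => w /= wn; rewrite -EFinM lee_fin s1 mulrA powRr1 ?(ltW (sup_deriv_gt0 w))//.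
        apply: ler_peMl; first exact/ltW/sup_deriv_gt0.
        rewrite -(opprB 1%R t) powRN ler_pdivlMr ?powR_gt0 ?sup_deriv_gt0// mul1r -wn.
        apply: ge0_ler_powR => //; rewrite ?nnegrE ?subr_ge0 ?(ltW t1)// ltW//.
        exact: sup_deriv_gt0.
      move=> /(lee_wpmul2l (powR_ge0 (D n) (t - 1) : 0 <= (D n `^ (t - 1))%:E)).
      rewrite mule1 muleA -EFinM -(opprB 1%R t) powRN mulVf ?mul1e//.
      by rewrite gt_eqF// powR_gt0.
    rewrite mulrCA -mulrDr -lnD -ln_powR -lne_EFin ?powR_gt0//.
    rewrite lee_lne// in_itv/= leey andbT; first by rewrite lee_fin powR_ge0.
    by apply: le_trans Zt; rewrite lee_fin powR_ge0.
  by rewrite lee_fin leNgt nmulr_lgt0// subr_lt0 t1.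
- have : 0 <= ((t - 1) * ln r)%:E :> \bar R.
    apply: (lee_cvg_to Pt
      (@scaled_affine_cvg ((t - 1) * ln K + ln k) ((t - 1) * ln r))%R).
    exists 1%N => // n /= n0; apply: pressure_seq_le => //.
    have Zt : word_sum n t <= (D n `^ (t - 1) * k)%:E.
      rewrite EFinM; apply: (@le_trans _ _ ((D n `^ (t - 1))%:E * word_sum n 1)); last first.
        by rewrite lee_wpmul2l// lee_fin powR_ge0.
      apply: le_trans (le_esumZ _ (powR_ge0 _ _) _) => [|w]; last by rewrite lee_fin powR_ge0.
      apply: le_esum => w /= wn; rewrite -EFinM lee_fin s1 powRr1 ?(ltW (sup_deriv_gt0 w))//.
      rewrite ler_wpM2r ?(ltW (sup_deriv_gt0 w))// -wn.
      by apply: ge0_ler_powR => //; rewrite ?nnegrE ?subr_ge0 ?(ltW t1)// ltW// sup_deriv_gt0.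
    rewrite addrAC mulrCA -mulrDr -lnD -ln_powR -lnM ?qualifE/= ?powR_gt0//.
    rewrite -lne_EFin ?mulr_gt0 ?powR_gt0//.
    rewrite lee_lne// in_itv/= leey andbT; last first.
      by rewrite lee_fin mulr_ge0 ?powR_ge0// ltW.
    by apply: esum_ge0 => w _; rewrite lee_fin powR_ge0.
  by rewrite lee_fin leNgt pmulr_rlt0 ?subr_gt0// lnr.
Qed.

End pressure.

(** * Conformal measures *)

Section conformal_uniqueness.
Local Open Scope ereal_scope.
Context {R : realType} (d : R) (f : nat -> R -> R).
Hypotheses (d1 : (1 < d)%R) (Gf : decaying_gauss_like d f).
Local Notation borelR := (measurableTypeR R).
Local Notation lam := (@lebesgue01 R).
Implicit Types (w : seq nat) (m : probability borelR R).

Lemma lebesgue01_attractor : lam (attractor f) = 1.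
Proof.
rewrite -lebesgue01_unit; apply: (measure_eq_mod (m := lam)
  (measurable_endpoints f) (lebesgue01_endpoints f)).
- exact: (measurable_attractor d1 Gf).
- exact: measurable_unit_itv.
- by move=> x [/(attractor_unit d1 Gf)].
- by move=> x [xI nx]; exact: (attractor_cocountable d1 Gf).
Qed.

Lemma conformal_lebesgue01 : conformal f 1 lam.
Proof.
split; first exact: lebesgue01_attractor.
- move=> i A mA AI; have jf := jacobian_lebesgue (gauss_regular Gf i).
  rewrite -[in LHS](setIidl AI) [LHS]jf// integral_abs_deriv (setIidl AI).
  by apply: eq_integral => x _; rewrite powRr1.
- move=> i j ij; apply: lebesgue01_countable.
  apply: (sub_countable _ (countable_endpoints f)); apply: subset_card_le.
  move=> _ [[x xI <-] [y yI yx]].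
  by apply: (images_overlap_endpoints Gf ij xI yI).
Qed.

Lemma conformal_jacobian m i : conformal f 1 m -> has_jacobian m (f i).
Proof.
move=> [_ H _] A mA; have mAI := measurableI _ _ mA (measurable_unit_itv (R := R)).
etransitivity; first by apply: (H i) => // x [].
by rewrite integral_abs_deriv; apply: eq_integral => x _; rewrite powRr1.
Qed.

Lemma conformal_jacobian_word m w : conformal f 1 m ->
  has_jacobian m (word_map f w).
Proof.
move=> cm; apply: jacobian_word => i; first exact: (gauss_regular Gf).
exact: conformal_jacobian.
Qed.

Lemma conformal_attractorC m : conformal f 1 m -> m (~` attractor f) = 0.
Proof.
move=> [mJ _ _]; rewrite probability_setC ?mJ ?subee//.
exact: (measurable_attractor d1 Gf).
Qed.

Lemma conformal_unit m : conformal f 1 m -> m unit_itv = 1.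
Proof.
move=> cm; have [<- _ _] := cm.
apply: (measure_eq_mod (measurableC (measurable_attractor d1 Gf)) (conformal_attractorC cm)).
- exact: measurable_unit_itv.
- exact: (measurable_attractor d1 Gf).
- by move=> x [_ /contrapT].
- by move=> x [/(attractor_unit d1 Gf)].
Qed.

(* Splitting [|f_w'| = s + (|f_w'| - s)] with [s = sup |f_w'| / kappa], the
   constant part contributes equally to both measures, so the bound [C] is
   only needed for the rest. *)
Lemma conformal_improve m (kappa C : R) : (1 <= kappa)%R ->
  (forall w x, unit_itv x ->
    (sup_deriv (word_map f w) <= kappa * `|derive01 (word_map f w) x|)%R) ->
  conformal f 1 m -> (1 <= C)%R ->
  (forall A : set borelR, measurable A -> m A <= C%:E * lam A) ->
  forall A : set borelR, measurable A -> m A <= (C - (C - 1) / kappa)%:E * lam A.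
Proof.
move=> k1 Hk cm C1 mC; have k0 : (0 < kappa)%R by exact: lt_le_trans k1.
have C0 : (0 <= C)%R by exact: le_trans C1.
have mI := measurable_unit_itv (R := R).
apply: (le_lebesgue01_cylinders d1 Gf).
- rewrite subr_ge0 ler_pdivrMr// (le_trans (_ : _ <= C * 1)%R) ?mulr1 ?gerBl//.
  by rewrite ler_peMr.
- exact: conformal_attractorC.
move=> w; pose s := (sup_deriv (word_map f w) / kappa)%R.
have s0 : (0 <= s)%R by rewrite divr_ge0 ?ltW// (sup_deriv_gt0 d1 Gf).
have sf x : unit_itv x -> (s <= `|derive01 (word_map f w) x|)%R.
  by move=> xI; rewrite ler_pdivrMr// mulrC; exact: Hk.
pose psi : borelR -> \bar R :=
  (fun x => (`|derive01 (word_map f w) x| - s)%:E) \_ unit_itv.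
have psi0 x : 0 <= psi x.
  rewrite /psi patchE; case: ifPn => // /[!inE] xI.
  by rewrite lee_fin subr_ge0; exact: sf.
have mpsi : measurable_fun (setT : set borelR) psi.
  apply/(measurable_restrictT _ mI)/measurable_EFinP.
  apply: measurable_funB => //; apply: measurableT_comp => //.
  apply: subspace_continuous_measurable_fun => //.
  by have [] := gauss_word_C1 Gf w.
have split_int (n : {measure set borelR -> \bar R}) : n unit_itv = 1 ->
    has_jacobian n (word_map f w) ->
    n (word_map f w @` unit_itv) = s%:E + \int[n]_(x in unit_itv) psi x.
  move=> nI jn; rewrite -[in LHS](setIid unit_itv) jn//.
  rewrite -[s%:E]mule1 -nI -integral_cst// -ge0_integralD//; last first.
    exact: measurable_funTS.
  apply: eq_integral => x /[!inE] xI; rewrite /abs_deriv /psi !patchE !mem_set//.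
  by rewrite /cst -EFinD subrKC.
have lamw := split_int lam lebesgue01_unit (jacobian_gauss_word Gf w).
have mw := split_int m (conformal_unit cm) (conformal_jacobian_word w cm).
have le_int : \int[m]_(x in unit_itv) psi x <= C%:E * \int[lam]_(x in unit_itv) psi x.
  have <- : \int[mscale (NngNum C0) lam]_(x in unit_itv) psi x =
      C%:E * \int[lam]_(x in unit_itv) psi x.
    by rewrite ge0_integral_mscale//; exact: measurable_funTS.
  by apply: ge0_le_measure_integral => // A mA; exact: mC.
have lamw_le : lam (word_map f w @` unit_itv) <= (sup_deriv (word_map f w))%:E.
  have := lebesgue01_word_le d1 Gf w mI.
  by rewrite setIid [X in _ <= _ * X]lebesgue01_unit mule1.
rewrite mw; apply: (le_trans (leeD2l _ le_int)).
rewrite [X in _ <= _ * X]lamw; move: lamw_le; rewrite [X in X <= _ -> _]lamw.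
have X0 : 0 <= \int[lam]_(x in unit_itv) psi x by exact: integral_ge0.
move: X0; case: (\int[lam]_(x in unit_itv) psi x) => [x|//|//]; last first.
rewrite -EFinM -!EFinD !lee_fin => x0 sx.
have sE : (sup_deriv (word_map f w) = s * kappa)%R by rewrite divfK// gt_eqF.
(* Here [s + x] is the length of the cylinder, at most [s * kappa = sup |f_w'|], so the last summand
   is nonnegative. *)
have -> : ((C - (C - 1) / kappa) * (s + x) =
    s + C * x + (C - 1) * (s - (s + x) / kappa))%R by field; rewrite gt_eqF.
rewrite lerDl mulr_ge0// subr_ge0// ler_pdivrMr//.
by rewrite -sE.
Qed.

Lemma conformal_lebesgue01_unique m : conformal f 1 m ->
  forall A : set borelR, measurable A -> m A = lam A.
Proof.
move=> cm; have [k0 k01 Hk0] := sup_deriv_distortion Gf.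
(* Enlarging the distortion constant makes it strictly greater than 1, so that the ratio [q] lies
   strictly between 0 and 1. *)
pose k := (k0 + 1)%R.
have k1 : (1 < k)%R by rewrite ltrDr (lt_le_trans ltr01).
have kgt0 : (0 < k)%R by exact: lt_trans k1.
have Hk w x : unit_itv x ->
    (sup_deriv (word_map f w) <= k * `|derive01 (word_map f w) x|)%R.
  move=> xI; apply: (le_trans (Hk0 w x xI)).
  by rewrite ler_wpM2r// lerDl.
pose q := (1 - k^-1)%R.
have q0 : (0 < q)%R by rewrite subr_gt0 invf_lt1.
have q1 : (q < 1)%R by rewrite ltrBlDr ltrDl invr_gt0.
have km0 : (0 < k - 1)%R by rewrite subr_gt0.
(* The excess of the constant over 1 starts at [k - 1], from bounded distortion, and each use of
   [conformal_improve] multiplies it by [q]. *)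
have iter_bound n : forall A : set borelR, measurable A ->
    m A <= (1 + (k - 1) * q ^+ n)%:E * lam A.
  elim: n => [|n IH].
    rewrite expr0 mulr1 subrKC; apply: (le_lebesgue01_cylinders d1 Gf) => //.
    - exact: ltW.
    - exact: conformal_attractorC.
    move=> w; have mI := measurable_unit_itv (R := R).
    apply: (@le_trans _ _ (sup_deriv (word_map f w))%:E).
      rewrite -[leRHS]mule1 -(conformal_unit cm) -(setIid unit_itv).
      apply: jacobian_le => //.
      + exact: (gauss_word_C1 Gf).
      + exact: conformal_jacobian_word.
      + by rewrite ltW// (sup_deriv_gt0 d1 Gf).
      + by move=> x; exact: (le_sup_deriv d1 Gf).
    have := lebesgue01_word_ge d1 Gf w (ltW k1) Hk mI.
    rewrite setIid [X in _ * X <= _ -> _]lebesgue01_unit mule1.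
    move=> /(lee_wpmul2l (ltW kgt0 : 0 <= k%:E)); apply: le_trans.
    by rewrite -EFinM mulrC divfK// gt_eqF.
  move=> A mA; have C1 : (1 <= 1 + (k - 1) * q ^+ n)%R.
    by rewrite lerDl mulr_ge0 ?exprn_ge0 ?ltW.
  have := conformal_improve (ltW k1) Hk cm C1 IH mA.
  suff -> : (1 + (k - 1) * q ^+ n - (1 + (k - 1) * q ^+ n - 1) / k =
    1 + (k - 1) * q ^+ n.+1)%R by [].
  by rewrite exprSr /q; field; rewrite gt_eqF.
have le_mlam (A : set borelR) : measurable A -> m A <= lam A.
  move=> mA; apply/lee_addgt0Pr => e e0.
  have [n /(_ n (leqnn n)) Hn] := exp_small km0 q0 q1 e0.
  apply: (le_trans (iter_bound n _ mA)).
  have lA1 : lam A <= 1 by exact: probability_le1.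
  have lA0 : 0 <= lam A by exact: measure_ge0.
  move: lA0 lA1; case: (lam A) => [a|//|//].
  rewrite -EFinM -EFinD !lee_fin => a0 a1.
  by rewrite mulrDl mul1r lerD2l (le_trans _ (ltW Hn))// ler_piMr// mulr_ge0 ?exprn_ge0 ?ltW.
move=> A mA; apply/eqP; rewrite eq_le le_mlam//=.
have lC : lam (~` A) = 1 - lam A by exact: probability_setC mA.
have := le_mlam _ (measurableC mA); rewrite probability_setC// lC.
have : m A \is a fin_num by exact: fin_num_measure.
have : lam A \is a fin_num by exact: (fin_num_measure lam).
case: (lam A) => // a _; case: (m A) => // b _.
by rewrite -!EFinB !lee_fin lerD2l lerN2.
Qed.

End conformal_uniqueness.

(** * The shift and its invariant measure *)

Section shift.
Local Open Scope ereal_scope.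
Context {R : realType} (d : R) (f : nat -> R -> R).
Hypotheses (d1 : (1 < d)%R) (Gf : decaying_gauss_like d f).
Local Notation borelR := (measurableTypeR R).
Local Notation lam := (@lebesgue01 R).
Local Notation S := (shift_preimage f).
Implicit Types (w : seq nat) (A B : set R).

(** Eliminates the choice hidden in [digits]: by uniqueness, prefixing [i] to any code of [y] gives
    the digits of [f i y]. The right-hand side is visibly Borel when [A] is. *)
Lemma shift_preimageE A :
  S A = uniquely_coded f `&` \bigcup_i (f i @` (A `&` attractor f)).
Proof.
apply/seteqP; split=> x [Ux].
  move=> Ax; split => //.
  have dx : coding f (digits f x) = x.
    have [a [ax _]] := Ux; exact: (@getPex _ [set a | coding f a = x] (ex_intro _ a ax)).
  exists (digits f x 0%N) => //.
  exists (coding f (fun n => digits f x n.+1)); last by rewrite -(coding_cons d1 Gf).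
  by split => //; eexists.
move=> [i _ [y [Ay [b _ yb]] fx]]; split => //=.
move: fx Ay; rewrite -{y}yb => fx Ay.
pose a n := if n is k.+1 then b k else i.
have ax : coding f a = x by rewrite (coding_cons d1 Gf).
have [c [_ cU]] := Ux.
have dx : coding f (digits f x) = x.
  exact: (@getPex _ [set a | coding f a = x] (ex_intro _ a ax)).
have da : digits f x = a by rewrite -(cU _ ax) -(cU _ dx).
by rewrite /digit_shift da.
Qed.

Lemma uniquely_coded_unit : uniquely_coded f `<=` unit_itv.
Proof. by move=> x [a [<- _]]; exact: (coding_unit d1 Gf). Qed.

Lemma measurable_uniquely_coded : measurable (uniquely_coded f : set borelR).
Proof.
apply: measurable_cocountable01; first exact: uniquely_coded_unit.
exact: (uniquely_coded_cocountable d1 Gf).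
Qed.

Lemma measurable_shift_preimage (A : set borelR) : measurable A ->
  measurable (S A : set borelR).
Proof.
move=> mA; rewrite shift_preimageE; apply: measurableI.
  exact: measurable_uniquely_coded.
apply: bigcupT_measurable => i; rewrite -(attractorI d1 Gf) setIA.
apply: (regular01_measurable_image (gauss_regular Gf i)).
by apply: measurableI => //; exact: (measurable_attractor d1 Gf).
Qed.

Lemma measurable_iter_shift n (A : set borelR) : measurable A ->
  measurable (iter n S A : set borelR).
Proof. by move=> mA; elim: n => [//|n IH]; exact: measurable_shift_preimage. Qed.

Lemma iter_shiftI n A B : iter n S (A `&` B) = iter n S A `&` iter n S B.
Proof.
elim: n => [//|n IH]; rewrite !iterS IH /shift_preimage preimage_setI.
by rewrite setIACA setIid.
Qed.

Lemma iter_shiftU n A B : iter n S (A `|` B) = iter n S A `|` iter n S B.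
Proof.
elim: n => [//|n IH]; rewrite !iterS IH /shift_preimage preimage_setU.
by rewrite setIUr.
Qed.

Lemma iter_shift0 n : iter n S set0 = set0.
Proof.
by elim: n => [//|n IH]; rewrite !iterS IH /shift_preimage preimage_set0 setI0.
Qed.

(** The complement of [0,1] is included because [iter 0 S A] is [A] itself, which may contain points
    there. *)
Definition negligible01 : set borelR := endpoints f `|` ~` unit_itv.

Lemma measurable_negligible01 : measurable negligible01.
Proof.
apply: measurableU; first exact: measurable_endpoints.
by apply: measurableC; exact: measurable_unit_itv.
Qed.

Lemma lebesgue01_negligible01 : lam negligible01 = 0.
Proof.
apply/eqP; rewrite eq_le measure_ge0 andbT.
apply: (le_trans (measureU2 lam _ _)).
- exact: measurable_endpoints.
- by apply: measurableC; exact: measurable_unit_itv.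
- by rewrite [X in X + _]lebesgue01_endpoints [X in _ + X]lebesgue01_outside adde0.
Qed.

Lemma notin_negligible01 x : ~ negligible01 x -> unit_itv x /\ ~ endpoints f x.
Proof. by move=> /not_orP[nx /contrapT xI]. Qed.

(** Together with the next lemma, this identifies the n-th preimage of [A] with the union of the
    images f_w(A) over words of length n, up to [negligible01]. *)
Lemma iter_shift_words_sub n A x : ~ negligible01 x -> iter n S A x ->
  exists w z, [/\ size w = n, A z, unit_itv z & word_map f w z = x].
Proof.
elim: n x => [|n IH] x /notin_negligible01[xI nx].
  by move=> Ax; exists [::], x.
rewrite iterS shift_preimageE => -[Ux [i _ [y [Ay Jy] fx]]].
have yI := attractor_unit d1 Gf Jy.
have [|w [z [wn Az zI wz]]] := IH y _ Ay.
  by move=> [ey|//]; apply: nx; rewrite -fx; exact: (endpoints_word [:: i]).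
by exists (i :: w), z; split => //=; rewrite ?wn// wz.
Qed.

Lemma words_iter_shift_sub w A z : A z -> unit_itv z ->
  ~ endpoints f (word_map f w z) -> iter (size w) S A (word_map f w z).
Proof.
elim: w => [//|i w IH] Az zI nx; rewrite [size _]/= iterS shift_preimageE.
have xI := gauss_word_unit Gf (i :: w) zI.
split; first exact: (uniquely_coded_cocountable d1 Gf).
exists i => //; exists (word_map f w z) => //.
have ny : ~ endpoints f (word_map f w z).
  by move=> ey; apply: nx; exact: (endpoints_word [:: i]).
split; first exact: IH.
by apply: (attractor_cocountable d1 Gf) => //; exact: (gauss_word_unit Gf).
Qed.

Lemma lebesgue01_iter_shift n (A : set borelR) : measurable A ->
  lam (iter n S A) =
  \esum_(w in [set w : seq nat | size w = n]) lam (word_map f w @` (A `&` unit_itv)).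
Proof.
move=> mA; rewrite -(@measure_word_images _ d f Gf lam n)//; last first.
  exact: lebesgue01_endpoints.
apply: (measure_eq_mod (m := lam) measurable_negligible01 lebesgue01_negligible01).
- exact: measurable_iter_shift.
- by apply: measurable_bigcup_countable => w _; exact: (measurable_word_image Gf).
- move=> x [Ax nx]; have [w [z [wn Az zI wz]]] := iter_shift_words_sub nx Ax.
  by exists w => //; exists z.
- move=> x [[w wn [z [Az zI] wz]] /notin_negligible01[xI nx]].
  by rewrite -wn -wz; apply: words_iter_shift_sub => //; rewrite wz.
Qed.

Lemma lebesgue01I (A : set borelR) : lam (A `&` unit_itv) = lam A.
Proof. by rewrite /lebesgue01/= /mrestr -setIA setIid. Qed.

(** Relative to its cylinder, the image of [A] has nearly the measure of [A], uniformly in [w]. With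
    s = sup |f_w'|, the measure of f_w(A) lies between (s/kappa) Leb A and s Leb A, and the case of
    [0,1] trades s for the cylinder length at the cost of a single kappa in each bound. *)
Lemma lebesgue01_word_comparable : exists2 kappa : R, (1 <= kappa)%R &
  forall w (A : set borelR), measurable A ->
    lam (word_map f w @` (A `&` unit_itv)) <=
      kappa%:E * lam A * lam (word_map f w @` unit_itv) /\
    (kappa^-1)%:E * lam A * lam (word_map f w @` unit_itv) <=
      lam (word_map f w @` (A `&` unit_itv)).
Proof.
have [k k1 Hk] := sup_deriv_distortion Gf; exists k => // w A mA.
have k0 : (0 < k)%R by exact: lt_le_trans k1.
have mI := measurable_unit_itv (R := R).
have s0 := sup_deriv_gt0 d1 Gf w.
have := lebesgue01_word_le d1 Gf w mA.
have := lebesgue01_word_ge d1 Gf w k1 Hk mA.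
have := lebesgue01_word_le d1 Gf w mI.
have := lebesgue01_word_ge d1 Gf w k1 Hk mI.
have lU : lam unit_itv = 1 by exact: lebesgue01_unit.
have lAI : lam (A `&` unit_itv) = lam A by exact: lebesgue01I.
rewrite lAI setIid lU !mule1.
have la (X : set borelR) : measurable X -> lam X \is a fin_num.
  by move=> mX; exact: (fin_num_measure lam).
have := la _ (measurable_word_image Gf w mI); rewrite setIid.
have := la _ (measurable_word_image Gf w mA).
have := la _ mA; have : 0 <= lam A by exact: measure_ge0.
case: (lam A) => [a| |]// a0 _; case: (lam (_ @` (_ `&` _))) => [y| |]// _.
case: (lam (_ @` unit_itv)) => [x| |]// _.
rewrite -!EFinM !lee_fin; rewrite lee_fin in a0.
set s := sup_deriv _ => sx xs sy ys; split.
- apply: (le_trans ys); rewrite mulrAC ler_wpM2r// mulrC.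
  by rewrite -ler_pdivrMr.
- apply: le_trans sy; rewrite mulrAC ler_wpM2r// mulrC.
  by rewrite ler_wpM2r// invr_ge0 ltW.
Qed.

(** The inequality not given by [le_esumZ] is [le_esumZ] for the inverse constant. *)
Lemma esumZ (I : choiceType) (D : set I) (a : I -> \bar R) (c : R) :
  (0 <= c)%R -> (forall i, 0 <= a i) ->
  \esum_(i in D) (c%:E * a i) = c%:E * \esum_(i in D) a i.
Proof.
move=> c0 a0; apply/eqP; rewrite eq_le le_esumZ//=.
have [->|cn0] := eqVneq c 0%R.
  by rewrite mul0e esum_ge0// => i _; rewrite mul0e.
have {c0 cn0}c0 : (0 < c)%R by rewrite lt_neqAle eq_sym cn0.
rewrite -lee_pdivlMl//; apply: le_trans (le_esumZ _ _ _); last 2 first.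
- by rewrite invr_ge0 ltW.
- by move=> i; rewrite mule_ge0// lee_fin ltW.
apply: le_esum => i _; rewrite muleA -EFinM mulVf ?mul1e//.
by rewrite gt_eqF.
Qed.

Lemma lebesgue01_iter_shift_comparable : exists2 kappa : R, (1 <= kappa)%R &
  forall n (A : set borelR), measurable A ->
    lam (iter n S A) <= kappa%:E * lam A /\ (kappa^-1)%:E * lam A <= lam (iter n S A).
Proof.
have [k k1 H] := lebesgue01_word_comparable; exists k => // n A mA.
have k0 : (0 < k)%R by exact: lt_le_trans k1.
have [a a0 lA] : exists2 a : R, (0 <= a)%R & lam A = a%:E.
  have la : lam A \is a fin_num by exact: (fin_num_measure lam).
  exists (fine (lam A)); first by apply: fine_ge0; exact: measure_ge0.
  by rewrite fineK.
rewrite lebesgue01_iter_shift// lA; split.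
- apply: (@le_trans _ _ (\esum_(w in [set w : seq nat | size w = n])
    ((k * a)%:E * lam (word_map f w @` unit_itv)))).
    by apply: le_esum => w _; have [+ _] := H w A mA; rewrite lA -EFinM.
  by rewrite esumZ ?(lebesgue01_words d1 Gf) ?mule1 ?EFinM// mulr_ge0// ltW.
- apply: (@le_trans _ _ (\esum_(w in [set w : seq nat | size w = n])
    ((k^-1 * a)%:E * lam (word_map f w @` unit_itv)))); last first.
    by apply: le_esum => w _; have [_] := H w A mA; rewrite lA -EFinM.
  by rewrite esumZ ?(lebesgue01_words d1 Gf) ?mule1 ?EFinM// mulr_ge0// invr_ge0 ltW.
Qed.

Lemma lebesgue01_iter_shiftT n : lam (iter n S setT) = 1.
Proof.
rewrite lebesgue01_iter_shift; last exact: measurableT.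
by rewrite setTI (lebesgue01_words d1 Gf).
Qed.

End shift.

(** * Limits of averaged measures along an ultrafilter *)

Section dominated_additive.
Local Open Scope ereal_scope.
Context dd (T : measurableType dd) {R : realType}.
Variables (mu : set T -> R) (n : {measure set T -> \bar R}).
Hypothesis mu_ge0 : forall A, (0 <= mu A)%R.
Hypothesis muU : forall A B, measurable A -> measurable B -> [disjoint A & B] ->
  mu (A `|` B) = (mu A + mu B)%R.
Hypothesis mu_le : forall A, measurable A -> (mu A)%:E <= n A.
Hypothesis n_fin : n setT < +oo.

(** By finite additivity, the partial sums differ from the mass of the union by the mass of a tail.
    The tails decrease to the empty set, so the finite measure [n], and with it [mu], tends to 0 on
    them. *)
Lemma dominated_semi_sigma_additive : semi_sigma_additive (fun A => (mu A)%:E).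
Proof.
move=> F mF tF mUF.
pose tail k := \bigcup_(i in [set i | (k <= i)%N]) F i.
have mtail k : measurable (tail k) by exact: bigcup_measurable.
have tail_cap : \bigcap_k tail k = set0.
  rewrite -subset0 => x xt; have [i _ Fi] := xt 0%N I.
  have [j /= ij Fj] := xt i.+1 I.
  by have E := tF i j I I (ex_intro _ x (conj Fi Fj)); rewrite E ltnn in ij.
have ntail : n (tail k) @[k --> \oo] --> 0.
  rewrite -(measure0 n) -tail_cap; apply: nonincreasing_cvg_mu => //.
  - apply: le_lt_trans n_fin; apply: le_measure; rewrite ?inE//.
  - by rewrite tail_cap.
  - apply/nonincreasing_seqP => k; apply/subsetPset => x [i /= ki Fi].
    by exists i => //=; exact: ltnW.
have mu_tail k : tail k = F k `|` tail k.+1.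
  apply/seteqP; split=> [x [i /= ki Fi]|x [Fk|[i /= ki Fi]]].
  - move: ki; rewrite leq_eqVlt => /orP[/eqP ->|ki]; [by left|right].
    by exists i.
  - by exists k => /=.
  - by exists i => //=; exact: ltnW.
have dis k : [disjoint F k & tail k.+1].
  apply/disj_set2P; rewrite -subset0 => x [Fk [i /= ki Fi]].
  by have E := tF k i I I (ex_intro _ x (conj Fk Fi)); rewrite E ltnn in ki.
have sumE k : (\sum_(0 <= i < k) (mu (F i))%:E = (mu (\bigcup_i F i))%:E - (mu (tail k))%:E).
  rewrite sumEFin -EFinB; congr EFin; elim: k => [|k IH].
    rewrite big_nil (_ : tail 0%N = \bigcup_i F i) ?subrr//.
    by apply/seteqP; split=> x [i _ Fi]; exists i.
  rewrite big_nat_recr//= IH mu_tail muU//.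
  by ring.
have cB : (mu (\bigcup_i F i))%:E - (mu (tail k))%:E @[k --> \oo] -->
    (mu (\bigcup_i F i))%:E - 0.
  apply: cvgeB => //; first exact: cvg_cst.
  apply: (@squeeze_cvge _ _ _ _ (cst 0) _ (n \o tail)) => //; last exact: cvg_cst.
  by apply: nearW => k; rewrite lee_fin mu_ge0 mu_le.
by rewrite sube0 in cB; under eq_fun do rewrite sumE.
Qed.

End dominated_additive.

Section mean_along_ultrafilter.
Context {R : realType} (G : set_system nat) {GU : UltraFilter G}.

(** Compactness of [a,b] gives a cluster point, and an ultrafilter converges to each of its cluster
    points. *)
Lemma ultra_bounded_cvg (u : nat -> R) (a b : R) :
  (forall n, a <= u n <= b) -> cvg (u n @[n --> G]).
Proof.
move=> uab; have GP : ProperFilter (u n @[n --> G]) by exact: fmap_proper_filter.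
have Gab : G (u @^-1` `[a, b]%classic).
  by apply: filterE => n; rewrite /= in_itv/=; exact: uab.
have [p [_ pcl]] := @segment_compact R a b _ GP Gab.
apply/cvg_ex; exists p => A pA.
have [//|GA] := in_ultra_setVsetC (u @^-1` A) GU.
by have [y [/= nAy Ay]] := pcl (~` A) A GA pA.
Qed.

End mean_along_ultrafilter.

(** Packs a set function that exists only inside a proof, here a limit along an ultrafilter, into a
    probability. *)
Lemma probability_of_measure (R : realType) (mu : set (measurableTypeR R) -> \bar R) :
  mu set0 = 0%E -> (forall A, 0 <= mu A)%E -> semi_sigma_additive mu ->
  mu setT = 1%E ->
  exists P : probability (measurableTypeR R) R, forall A, P A = mu A.
Proof.
move=> mu0 mu_ge0 mu_s muT.
pose M := isMeasure.Build _ _ _ mu mu0 mu_ge0 mu_s.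
pose m : {measure set (measurableTypeR R) -> \bar R} := HB.pack mu M.
pose Pm := Measure_isProbability.Build _ _ R m muT.
pose P : probability (measurableTypeR R) R := HB.pack (m : set _ -> \bar R) m Pm.
by exists P.
Qed.

Section invariant_measure.
Context {R : realType} (d : R) (f : nat -> R -> R).
Hypotheses (d1 : 1 < d) (Gf : decaying_gauss_like d f).
Local Notation borelR := (measurableTypeR R).
Local Notation lam := (@lebesgue01 R).
Local Notation S := (shift_preimage f).
Implicit Types (A B : set borelR).

Definition iter_mass (k : nat) A : R := fine (lam (iter k S A)).

Lemma iter_massE k A : measurable A -> lam (iter k S A) = (iter_mass k A)%:E.
Proof.
move=> mA; rewrite fineK//; apply: (fin_num_measure lam).
exact: (measurable_iter_shift d1 Gf).
Qed.

Lemma iter_mass_ge0 k A : 0 <= iter_mass k A.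
Proof. by apply: fine_ge0; exact: measure_ge0. Qed.

Lemma iter_mass_le1 k A : measurable A -> iter_mass k A <= 1.
Proof.
move=> mA; rewrite -lee_fin -iter_massE//; apply: (probability_le1 lam).
exact: (measurable_iter_shift d1 Gf).
Qed.

Lemma iter_massT k : iter_mass k setT = 1.
Proof. by rewrite /iter_mass (lebesgue01_iter_shiftT d1 Gf). Qed.

Lemma iter_massU k A B : measurable A -> measurable B -> [disjoint A & B] ->
  iter_mass k (A `|` B) = iter_mass k A + iter_mass k B.
Proof.
move=> mA mB /disj_set2P AB; apply: EFin_inj.
rewrite EFinD -!iter_massE//; last exact: measurableU.
rewrite iter_shiftU; apply: (measureU lam).
- exact: (measurable_iter_shift d1 Gf).
- exact: (measurable_iter_shift d1 Gf).
- by rewrite -iter_shiftI AB iter_shift0.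
Qed.

Definition mean_mass (n : nat) A : R :=
  n.+1%:R^-1 * \sum_(k < n.+1) iter_mass k A.

Lemma mean_mass_le n A (c : R) : (forall k, iter_mass k A <= c) ->
  mean_mass n A <= c.
Proof.
move=> H; rewrite /mean_mass mulrC ler_pdivrMr//.
apply: (@le_trans _ _ (\sum_(k < n.+1) c)); first by apply: ler_sum => k _; exact: H.
by rewrite sumr_const card_ord mulr_natr.
Qed.

Lemma mean_mass_ge n A (c : R) : (forall k, c <= iter_mass k A) ->
  c <= mean_mass n A.
Proof.
move=> H; rewrite /mean_mass mulrC ler_pdivlMr//.
apply: (@le_trans _ _ (\sum_(k < n.+1) c)); last by apply: ler_sum => k _; exact: H.
by rewrite sumr_const card_ord mulr_natr.
Qed.

Lemma mean_mass_shift n A :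
  mean_mass n (S A) = mean_mass n A + n.+1%:R^-1 * (iter_mass n.+1 A - iter_mass 0 A).
Proof.
rewrite /mean_mass -mulrDr; congr (_ * _).
under eq_bigr do rewrite /iter_mass -iterSr -/(iter_mass _ _).
apply/eqP; rewrite addrC -subr_eq -sumrB.
rewrite -(big_mkord xpredT (fun k => iter_mass k.+1 A - iter_mass k A)).
by rewrite telescope_sumr.
Qed.

Lemma exists_comparable_invariant_measure : exists (kappa : R)
    (P : probability borelR R), [/\ 0 < kappa,
  (forall A, measurable A -> (P A <= kappa%:E * lam A)%E),
  (forall A, measurable A -> ((kappa^-1)%:E * lam A <= P A)%E) &
  (forall A, measurable A -> P (S A) = P A)].
Proof.
have [G [GU ooG]] := ultraFilterLemma (F := \oo) _.
have [k k1 Hk] := lebesgue01_iter_shift_comparable d1 Gf.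
have k0 : 0 < k by exact: lt_le_trans k1.
have GF : ProperFilter G by exact: ultra_proper.
pose L A := lim (mean_mass n A @[n --> G]).
have cvL A : measurable A -> mean_mass n A @[n --> G] --> L A.
  move=> mA; suff : cvg (mean_mass n A @[n --> G]) by [].
  apply: (@ultra_bounded_cvg _ _ _ _ 0 1) => n.
  rewrite mean_mass_ge ?mean_mass_le// => i; first exact: iter_mass_le1.
  exact: iter_mass_ge0.
have LE A l : mean_mass n A @[n --> G] --> l -> L A = l by move=> H; exact: cvg_lim.
have lamE A : measurable A -> lam A = (iter_mass 0 A)%:E.
  by move=> mA; rewrite -iter_massE.
have Lge0 A : measurable A -> 0 <= L A.
  move=> mA; apply: limr_ge; first exact: cvL.
  by apply: nearW => n; apply: mean_mass_ge => i; exact: iter_mass_ge0.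
have Lle A : measurable A -> L A <= k * iter_mass 0 A.
  move=> mA; apply: limr_le; first exact: cvL.
  apply: nearW => n; apply: mean_mass_le => i.
  by rewrite -lee_fin EFinM -(iter_massE i mA) -(lamE _ mA); have [] := Hk i A mA.
have Lge A : measurable A -> k^-1 * iter_mass 0 A <= L A.
  move=> mA; apply: limr_ge; first exact: cvL.
  apply: nearW => n; apply: mean_mass_ge => i.
  by rewrite -lee_fin EFinM -(iter_massE i mA) -(lamE _ mA); have [] := Hk i A mA.
have LU A B : measurable A -> measurable B -> [disjoint A & B] ->
    L (A `|` B) = L A + L B.
  move=> mA mB AB; apply: LE.
  have -> : (fun n => mean_mass n (A `|` B)) = (fun n => mean_mass n A + mean_mass n B).
    apply/funext => n; rewrite /mean_mass -mulrDr -big_split/=; congr (_ * _).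
    by apply: eq_bigr => i _; exact: iter_massU.
  by apply: cvgD; exact: cvL.
have LT : L setT = 1.
  apply: LE; have -> : (fun n => mean_mass n setT) = cst 1; last exact: cvg_cst.
  apply/funext => n; apply/eqP; rewrite eq_le mean_mass_le ?mean_mass_ge// => i;
  by rewrite iter_massT.
have LS A : measurable A -> L (S A) = L A.
  move=> mA; apply: LE.
  have -> : (fun n => mean_mass n (S A)) = (fun n => mean_mass n A +
      n.+1%:R^-1 * (iter_mass n.+1 A - iter_mass 0 A)).
    by apply/funext => n; exact: mean_mass_shift.
  suff : (fun n => mean_mass n A + n.+1%:R^-1 * (iter_mass n.+1 A - iter_mass 0 A))
      @ G --> L A + 0 by rewrite addr0.
  apply: cvgD; first exact: cvL.
  (* The two boundary masses lie in [0,1], so the telescoped difference is at most 1/(n+1) in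
     absolute value; the limit along [\oo] passes to the finer filter [G]. *)
  have : (fun n => n.+1%:R^-1 * (iter_mass n.+1 A - iter_mass 0 A)) @ \oo --> 0.
    apply: (@squeeze_cvgr _ _ _ _ (fun n => - harmonic n) harmonic).
    - apply: nearW => n; rewrite /= -mulrN1 !ler_pM2l//.
      have := iter_mass_le1 n.+1 mA; have := iter_mass_le1 0 mA.
      have := iter_mass_ge0 n.+1 A; have := iter_mass_ge0 0 A.
      rewrite -[X in _ && (_ <= X)]mulr1 ler_pM2l//; lra.
    - by rewrite -oppr0; apply: cvgN; exact: cvg_harmonic.
    - exact: cvg_harmonic.
  by move=> H B /H; exact: ooG.
(* The absolute value only matters on non-measurable sets, where [L] is an
   arbitrary value. *)
pose m A := `|L A|.
have mE A : measurable A -> m A = L A by move=> mA; rewrite /m ger0_norm// Lge0.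
have mU A B : measurable A -> measurable B -> [disjoint A & B] ->
    m (A `|` B) = m A + m B.
  by move=> mA mB AB; rewrite !mE ?LU//; exact: measurableU.
have [||||P PE] := @probability_of_measure R (fun A => (m A)%:E).
- have : m (set0 `|` set0) = m set0 + m set0.
    by apply: mU => //; apply/disj_set2P; rewrite setI0.
  by rewrite setU0 => E; congr EFin; lra.
- by move=> A; rewrite lee_fin /m normr_ge0.
- apply: (@dominated_semi_sigma_additive _ borelR R m
    (mscale (NngNum (ltW k0)) lam)).
  + by move=> A; exact: normr_ge0.
  + exact: mU.
  + move=> A mA; rewrite /= /mscale/= mE// [X in (_ <= _ * X)%E](lamE _ mA) -EFinM lee_fin.
    exact: Lle.
  + by rewrite /= /mscale/= [X in (_ * X < _)%E]lebesgue01_setT mule1 ltry.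
- by rewrite mE// LT.
exists k, P; split => // A mA.
- by rewrite PE mE// lamE// -EFinM lee_fin Lle.
- by rewrite PE mE// lamE// -EFinM lee_fin Lge.
- have mSA := measurable_shift_preimage d1 Gf mA.
  by rewrite !PE !mE// LS.
Qed.

End invariant_measure.

(** * Ergodicity *)

Section ergodicity.
Local Open Scope ereal_scope.
Context {R : realType} (d : R) (f : nat -> R -> R).
Hypotheses (d1 : (1 < d)%R) (Gf : decaying_gauss_like d f).
Local Notation borelR := (measurableTypeR R).
Local Notation lam := (@lebesgue01 R).
Local Notation S := (shift_preimage f).
Implicit Types (A B : set borelR).

(** Induction on n: a point where [A] and its preimage of order n+1 differ is one where [A] and
    [S A] differ, or lies in [S] of the symmetric difference at order n. By comparability, [S] sends
    null sets to null sets. *)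
Lemma lebesgue01_iter_invariant n A : measurable A -> lam (A `+` S A) = 0 ->
  lam (A `+` iter n S A) = 0.
Proof.
move=> mA A0; have [k k1 Hk] := lebesgue01_iter_shift_comparable d1 Gf.
have mS B : measurable B -> measurable (S B : set borelR).
  exact: (measurable_shift_preimage d1 Gf).
have mY B C : measurable B -> measurable C -> measurable (B `+` C : set borelR).
  by move=> mB mC; apply: measurableU; exact: measurableD.
have mn i : measurable (iter i S A : set borelR).
  exact: (measurable_iter_shift d1 Gf).
elim: n => [|n IH]; first by rewrite setYK measure0.
have mAn := mY _ _ mA (mn n).
have S0 : lam (S (A `+` iter n S A)) = 0.
  have [+ _] := Hk 1%N _ mAn; rewrite IH mule0 => H.
  by apply/eqP; rewrite eq_le measure_ge0 andbT.
apply/eqP; rewrite eq_le measure_ge0 andbT.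
apply: (@le_trans _ _ (lam ((A `+` S A) `|` S (A `+` iter n S A)))).
  apply: (le_measure lam); rewrite ?inE.
  - exact: (mY _ _ mA (mn n.+1)).
  - by apply: measurableU; [exact: (mY _ _ mA (mS _ mA))|exact: mS].
  - move=> x; have [SAx|nSAx] := pselect (S A x).
      move=> [[Ax nx]|[Sx nAx]]; last by left; right.
      right; have [Ux Tx] := SAx; split => //; left; split => // An.
      by apply: nx; split.
    move=> [[Ax nx]|[[Ux Tx] nAx]]; first by left; left.
    right; split => //; right; split => // TAx.
    by apply: nSAx; split.
apply: (le_trans (measureU2 lam _ _)).
- exact: (mY _ _ mA (mS _ mA)).
- exact: mS.
- by rewrite [X in X + _]A0 [X in _ + X]S0 adde0.
Qed.

Lemma lebesgue01_ergodic A : measurable A -> lam (A `+` S A) = 0 ->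
  lam A = 0 \/ lam (~` A) = 0.
Proof.
move=> mA A0; have [k k1 Hk] := lebesgue01_word_comparable d1 Gf.
have k0 : (0 < k)%R by exact: lt_le_trans k1.
have mI := measurable_unit_itv (R := R).
have la B : measurable B -> exists2 b : R, (0 <= b)%R & lam B = b%:E.
  move=> mB; have fB : lam B \is a fin_num by exact: (fin_num_measure lam).
  exists (fine (lam B)); first by apply: fine_ge0; exact: measure_ge0.
  by rewrite fineK.
have [a a0 lA] := la _ mA; have [b b0 lAC] := la _ (measurableC mA).
have a1 : (a <= 1)%R by rewrite -lee_fin -lA; exact: (probability_le1 lam).
have ak : (a / k <= 1)%R by rewrite ler_pdivrMr// mul1r (le_trans a1).
(* Up to null sets f_w(A) lies in the preimage of [A] of order [size w], which is [A] itself by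
   almost invariance, so it can be counted in the trace of [A] on the cylinder. *)
have cyl w : a%:E * (k^-1)%:E * lam (word_map f w @` unit_itv) <=
    lam (word_map f w @` unit_itv `&` A).
  have [_ H] := Hk w A mA; rewrite [X in X * _ <= _]muleC -lA; apply: (le_trans H).
  have mW := measurable_word_image Gf w mI; rewrite setIid in mW.
  set B := A `+` iter (size w) S A.
  have mn : measurable (iter (size w) S A : set borelR).
    exact: (measurable_iter_shift d1 Gf).
  have mB : measurable B by apply: measurableU; exact: measurableD.
  have B0 : lam B = 0 by exact: lebesgue01_iter_invariant.
  have mE := measurable_endpoints f.
  apply: (@le_trans _ _ (lam ((word_map f w @` unit_itv `&` A) `|` (B `|` endpoints f)))).
    apply: (le_measure lam); rewrite ?inE.
    - exact: (measurable_word_image Gf).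
    - by apply: measurableU; [exact: measurableI|exact: measurableU].
    - move=> x [z [Az zI] wz].
      have [Ax|nAx] := pselect (A x); first by left; split => //; exists z.
      right; have [ex|nex] := pselect (endpoints f x); [by right|left].
      by right; split => //; rewrite -wz; apply: (words_iter_shift_sub d1 Gf) => //; rewrite wz.
  apply: (le_trans (measureU2 lam _ _)).
  - exact: measurableI.
  - exact: measurableU.
  rewrite -[leRHS]adde0 leeD2l//.
  apply: (le_trans (measureU2 lam mB mE)).
  by rewrite [X in X + _]B0 [X in _ + X]lebesgue01_endpoints adde0.
have mAC := measurableC mA.
(* Each cylinder loses at least the fraction a/k to [A], so [mu] is at most (1 - a/k) [lam] on
   cylinders and hence on Borel sets. At the complement of [A] this reads b <= (1 - a/k) b, forcing
   a b = 0. *)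
pose mu : {measure set borelR -> \bar R} := mrestr lam mAC.
have := @le_lebesgue01_cylinders R d f d1 Gf mu (1 - a / k).
move=> /(_ _ _ _ _ mAC) H.
have : mu (~` A) <= (1 - a / k)%:E * lam (~` A).
  apply: H.
  - by rewrite subr_ge0.
  - apply/eqP; rewrite eq_le measure_ge0 andbT /mu/= /mrestr.
    rewrite -(_ : lam (~` attractor f) = 0); last first.
      have := probability_setC lam (measurable_attractor d1 Gf).
      by rewrite [X in _ = _ - X](lebesgue01_attractor d1 Gf) subee.
    apply: (le_measure lam); rewrite ?inE.
    + by apply: measurableI => //; apply: measurableC; exact: (measurable_attractor d1 Gf).
    + by apply: measurableC; exact: (measurable_attractor d1 Gf).
    + by move=> x [].
  - move=> w; have mW := measurable_word_image Gf w mI; rewrite setIid in mW.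
    have := cyl w; have [x x0 lx] := la _ mW.
    have [y y0 ly] := la _ (measurableI _ _ mW mA).
    have [z z0 lz] := la _ (measurableI _ _ mW mAC).
    have : lam (word_map f w @` unit_itv) = lam (word_map f w @` unit_itv `&` ~` A) +
        lam (word_map f w @` unit_itv `&` A).
      rewrite -setDE; exact: (measureDI lam).
    rewrite /mu/= /mrestr lx ly lz -!EFinM -EFinD !lee_fin => -[->].
    by move=> ?; lra.
rewrite /mu/= /mrestr setIid lAC -EFinM lee_fin mulrBl mul1r => Hb.
have : (a * b == 0)%R.
  rewrite eq_le mulr_ge0// andbT.
  have : (a / k * b <= 0)%R by lra.
  by rewrite mulrAC pmulr_lle0// invr_gt0.
by rewrite mulf_eq0 lA => /orP[/eqP->|/eqP->]; [left|right].
Qed.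

End ergodicity.

Section invariant_ergodic.
Local Open Scope ereal_scope.
Context {R : realType} (d : R) (f : nat -> R -> R).
Hypotheses (d1 : (1 < d)%R) (Gf : decaying_gauss_like d f).
Local Notation borelR := (measurableTypeR R).
Local Notation lam := (@lebesgue01 R).

(** Ergodicity depends only on which sets are null, and [P] has the same null sets as [lam]. *)
Lemma exists_ergodic_measure : exists mstar : probability borelR R,
  [/\ shift_invariant f mstar, shift_ergodic f mstar,
      mstar `<< lam & lam `<< mstar].
Proof.
have [k [P [k0 Ple Pge PS]]] := exists_comparable_invariant_measure d1 Gf.
have P0 (A : set borelR) : measurable A -> lam A = 0 -> P A = 0.
  move=> mA A0; apply/eqP; rewrite eq_le measure_ge0 andbT.
  by apply: (le_trans (Ple _ mA)); rewrite A0 mule0.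
have lam0 (A : set borelR) : measurable A -> P A = 0 -> lam A = 0.
  move=> mA A0; apply/eqP; rewrite eq_le measure_ge0 andbT.
  have := Pge _ mA; rewrite A0 pmule_rle0// lte_fin.
  by rewrite invr_gt0.
have mI := measurable_unit_itv (R := R).
have PC (A : set borelR) : measurable A -> P (~` A) = 0 -> P A = 1.
  move=> mA; rewrite probability_setC// => E.
  by have := probability_setC P (measurableC mA); rewrite setCK probability_setC// E sube0.
have mS := measurable_shift_preimage d1 Gf.
exists P; split.
- split.
  + by apply: PC => //; apply: P0; [exact: measurableC|exact: lebesgue01_outside].
  + apply: P0.
      by apply: measurableD => //; exact: (measurable_uniquely_coded d1 Gf).
    exact/lebesgue01_cocountable/(uniquely_coded_cocountable d1 Gf).
  + by move=> A mA; split; [exact: mS|exact: PS].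
- move=> A mA /lam0 A0.
  have [|A00|A00] := lebesgue01_ergodic d1 Gf mA.
  + by apply: A0; apply: measurableU; apply: measurableD => //; exact: mS.
  + by left; exact: P0.
  + by right; apply: PC => //; apply: P0 => //; exact: measurableC.
- by apply/(null_content_dominatesP P lam) => A mA; exact: P0.
- by apply/(null_content_dominatesP lam P) => A mA; exact: lam0.
Qed.

End invariant_ergodic.

Unset Implicit Arguments.

Theorem theorem1p5 (R : realType) (d : R) (f : nat -> R -> R) :
  1 < d -> decaying_gauss_like d f ->
  [/\ exists2 t : R, 0 <= t & pressure_is f t 0%E,
      (forall t : R, 0 <= t -> pressure_is f t 0%E ->
         conformal f t lebesgue01 /\
         (forall m : probability (measurableTypeR R) R, conformal f t m ->
            forall A, measurable A -> m A = lebesgue01 A)) &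
      exists mstar : probability (measurableTypeR R) R,
        [/\ shift_invariant f mstar, shift_ergodic f mstar,
            mstar `<< lebesgue01 & lebesgue01 `<< mstar]].
Proof.
move=> d1 Gf; split.
- by exists 1; [exact: ler01|exact: (pressure_at_one d1 Gf)].
- move=> t _ /(pressure_zero_unique d1 Gf) ->; split.
    exact: (conformal_lebesgue01 d1 Gf).
  by move=> m cm A mA; exact: (conformal_lebesgue01_unique d1 Gf cm mA).
- exact: (exists_ergodic_measure d1 Gf).
Qed.
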